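(* In the Markov decision setting with nonlinear discounting described in the context, suppose that: (A1) the correspondence $\Gamma:\mathsf X\to\mathsf A$ is compact-valued and continuous; (A2) the reward function $r$ is non-negative, bounded and continuous on $\mathsf G$; (A3) the map $a\mapsto\int v(H(y,a,z'),z')P(z,dz')$ is continuous on $\mathsf A$ for any $v\in bm\mathsf X$ and $(y,z)\in\mathsf X$; (N1) the map $\bar H(y,z'):=\sup_{a\in\mathsf A}H(y,a,z')$ from $\mathsf X$ to $\mathsf Y$ is well-defined and measurable and, for any given $z'\in\mathsf Z$, order-preserving on $\mathsf Y$; (N2) the discount operator $\beta$ is an order preserving self-map on $bm\mathsf X$; (N3) $\beta(v+w)\le\beta v+\beta w$ for all $v,w\in bm\mathsf X$; (N4) there exists a bounded and measurable function $\delta:\mathsf Z\to\mathbb R_+$ such that $(\beta v)(y,z)\le\delta(z)v(y,z)$ for all $v\in(bm\mathsf X)_+$ and $(y,z)\in\mathsf X$; (N5) the sequence $\sup_{z\in\mathsf Z}\mathbb E^P_z\prod_{t=1}^n\delta(Z_t)\downarrow0$ as $n\to\infty$. Then the fundamental optimality properties hold for $(V_b,\mathbb T_{ND})$, and VFI, OPI and HPI all converge.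
   Context: Setting. $\mathsf Y$ (endogenous states, also partially ordered) and $\mathsf Z$ (exogenous states) are topological spaces with Borel $\sigma$-algebras; $\mathsf X=\mathsf Y\times\mathsf Z$ with the product topology, its Borel $\sigma$-algebra being taken to be the product $\sigma$-algebra. The action space $\mathsf A$ is a separable metrizable space. $\Gamma$ is a nonempty-valued correspondence from $\mathsf X$ to $\mathsf A$, $\mathsf G=\{(x,a)\in\mathsf X\times\mathsf A:a\in\Gamma(x)\}$, $r:\mathsf G\to\mathbb R$ is a reward function, $P$ is a stochastic (probability) kernel on $\mathsf Z$, and $H:\mathsf Y\times\mathsf A\times\mathsf Z\to\mathsf Y$ is measurable. $\mathbb E^P_z$ is expectation for the Markov chain $(Z_t)$ with kernel $P$ and $Z_0=z$. $bm\mathsf X$ is the space of bounded Borel measurable real functions on $\mathsf X$ with the pointwise order $\le$, and $(bm\mathsf X)_+$ its nonnegative elements. $\beta$ is an operator (the discount operator) acting on $bm\mathsf X$. Let $b\in(bm\mathsf X)_+$ be the unique fixed point in $(bm\mathsf X)_+$ of $(Sv)(x)=\sup_{(x,a)\in\mathsf G}r(x,a)+\int\delta(z')v(\bar H(y,z'),z')P(z,dz')$, $x=(y,z)$, where the supremum is over all of $\mathsf G$ (a constant); $b$ exists and is unique under the assumptions. Put $V_b=[0,b]=\{v\in bm\mathsf X:0\le v\le b\}$. $\Sigma$ is the set of feasible policies: Borel measurable $\sigma:\mathsf X\to\mathsf A$ with $\sigma(x)\in\Gamma(x)$ for all $x$. For $\sigma\in\Sigma$, $v\in V_b$, $x=(y,z)$,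 $$(T_\sigma v)(x)=r(x,\sigma(x))+\int(\beta v)(H(y,\sigma(x),z'),z')P(z,dz'),$$ and $\mathbb T_{ND}=\{T_\sigma:\sigma\in\Sigma\}$. Abstract dynamic programs. An abstract dynamic program (ADP) is a pair $(V,\mathbb T)$ where $V=(V,\preceq)$ is a poset and $\mathbb T=\{T_\sigma:\sigma\in\Sigma\}$ is a nonempty family of order preserving self-maps on $V$. Given $v\in V$, $\sigma\in\Sigma$ is $v$-greedy if $T_\tau v\preceq T_\sigma v$ for all $\tau\in\Sigma$. The Bellman operator is $Tv:=\bigvee_\sigma T_\sigma v$ whenever the supremum exists; $v\in V$ solves the Bellman equation if $Tv$ exists and $Tv=v$. $(V,\mathbb T)$ is well-posed if each $T_\sigma$ has a unique fixed point $v_\sigma$ in $V$, and regular if a $v$-greedy policy exists for every $v\in V$. When $(V,\mathbb T)$ is well-posed, $V_\Sigma:=\{v_\sigma:\sigma\in\Sigma\}$; $\sigma$ is optimal if $v_\sigma$ is a greatest element of $V_\Sigma$; and the value function is $v^*:=\bigvee V_\Sigma$ whenever the supremum exists. Bellman's principle of optimality holds if $(V,\mathbb T)$ is well-posed and $\{\sigma\in\Sigma:\sigma\text{ is optimal}\}=\{\sigma\in\Sigma:\sigma\text{ is }v^*\text{-greedy}\}$ (both sets understood as empty if $v^*$ does not exist). The fundamental optimality properties hold if $(V,\mathbb T)$ is a well-posed and regular ADP and: (B1) at least one optimal policy exists; (B2) $v^*$ is the unique solution to the Bellman equation in $V$; (B3) Bellman's principle of optimality holds. Algorithms. Write $v_n\uparrow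 v$ if $(v_n)$ is increasing with supremum $v$, and $\downarrow$ analogously. Fix, for each $v\in V$, a choice of $v$-greedy policy $\sigma$. Set $\mathcal Hv:=v_\sigma$ (Howard policy operator) and, for $m\in\mathbb N$, $m\ge1$, $W_mv:=T_\sigma^m v$, where $\sigma$ is the chosen $v$-greedy policy. Let $V_U=\{v\in V:v\preceq Tv\}$. VFI converges if $T^nv\uparrow v^*$ for all $v\in V_U$; OPI converges if $W_m^nv\uparrow v^*$ for all $v\in V_U$ (for each $m$); HPI converges if $\mathcal H^nv\uparrow v^*$ for all $v\in V_U$. *)

(* Defs.v *)
From HB Require Import structures.
From mathcomp Require Import all_boot all_order all_algebra.
From mathcomp Require Import all_classical all_reals all_analysis.
From mathcomp Require Import measurable_realfun.

Set Implicit Arguments.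
Unset Strict Implicit.
Unset Printing Implicit Defensive.
Import Order.TTheory GRing.Theory Num.Theory.
Import numFieldNormedType.Exports.

Local Open Scope classical_set_scope.
Local Open Scope ring_scope.

(* These structures only put a topology and a sigma-algebra on the same
   carrier; that the latter is the Borel one has to be assumed separately. *)
#[short(type="measurableTopologicalType")]
HB.structure Definition MeasurableTopological d :=
  { T of Measurable d T & PointedTopological T }.

#[short(type="porderMeasurableTopologicalType")]
HB.structure Definition POrderedMeasurableTopological o d :=
  { T of Measurable d T & PointedTopological T & Order.isPOrder o T }.

#[short(type="measurableMetricType")]
HB.structure Definition MeasurableMetric (R : numDomainType) d :=
  { T of Measurable d T & PseudoPointedMetric R T & Metric R T }.

Definition separable (T : topologicalType) :=
  exists2 D : set T, countable D & dense D.

Section correspondence.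
Context (S T : topologicalType).
Implicit Type Gamma : S -> set T.

Definition upper_hemicontinuous Gamma :=
  forall x (U : set T), open U -> Gamma x `<=` U ->
    \forall x' \near x, Gamma x' `<=` U.

Definition lower_hemicontinuous Gamma :=
  forall x (U : set T), open U -> Gamma x `&` U !=set0 ->
    \forall x' \near x, Gamma x' `&` U !=set0.

Definition continuous_correspondence Gamma :=
  upper_hemicontinuous Gamma /\ lower_hemicontinuous Gamma.

End correspondence.

Definition graph (S T : Type) (Gamma : S -> set T) : set (S * T) :=
  [set xa | Gamma xa.1 xa.2].

Section lub.
Context {o : Order.disp_t} {E : porderType o}.
Implicit Types (V A : set E) (u : nat -> E).
Local Open Scope order_scope.

(* Supremum and infimum in the subposet V of E. *)
Definition lub_in V A v :=
  [/\ V v, ubound A v & forall w, V w -> ubound A w -> v <= w].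

Definition glb_in V A v :=
  [/\ V v, lbound A v & forall w, V w -> lbound A w -> w <= v].

Definition increases_to V u v :=
  (forall n, u n <= u n.+1) /\ lub_in V (range u) v.

Definition decreases_to V u v :=
  (forall n, u n.+1 <= u n) /\ glb_in V (range u) v.

End lub.

(* An abstract dynamic program (V, {T s | s in Sigma}), where the poset V is
   a subset of E with the induced order. The T s are total on E, but only
   their restrictions to V matter. *)
Section adp.
Context {o : Order.disp_t} {E : porderType o} {I : Type}.
Variables (V : set E) (Sigma : set I) (T : I -> E -> E).
Local Open Scope order_scope.

Definition is_adp :=
  [/\ Sigma !=set0,
      forall s v, Sigma s -> V v -> V (T s v)
    & forall s v w, Sigma s -> V v -> V w -> v <= w -> T s v <= T s w].

Definition greedy v s := Sigma s /\ forall t, Sigma t -> T t v <= T s v.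

(* is_bellman v w: the supremum T v exists in V and is equal to w. *)
Definition is_bellman v w := lub_in V [set T s v | s in Sigma] w.

(* The junk value v is returned when the supremum does not exist. *)
Definition bellman v := xget v (is_bellman v).

Definition solves_bellman v := V v /\ is_bellman v v.

(* is_policy_value s v: v is a fixed point v_s of T s in V. *)
Definition is_policy_value s v := V v /\ T s v = v.

Definition well_posed := forall s, Sigma s -> exists! v, is_policy_value s v.

Definition regular := forall v, V v -> exists s, greedy v s.

Definition policy_values := [set v | exists2 s, Sigma s & is_policy_value s v].

Definition optimal s :=
  Sigma s /\ exists2 v, is_policy_value s v & ubound policy_values v.

(* is_value vs: the value function exists and is equal to vs. *)
Definition is_value vs := lub_in V policy_values vs.

Definition principle_of_optimality :=
  well_posed /\
  forall s, optimal s <-> exists2 vs, is_value vs & greedy vs s.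

Definition fundamental_optimality :=
  [/\ [/\ is_adp, well_posed & regular],
      exists s, optimal s,
      exists vs, [/\ is_value vs, solves_bellman vs
                   & forall v, solves_bellman v -> v = vs]
    & principle_of_optimality].

Definition greedy_choice (g : E -> I) := forall v, V v -> greedy v (g v).

(* The junk value v is returned when T (g v) has no fixed point in V. *)
Definition howard (g : E -> I) v := xget v (is_policy_value (g v)).

Definition optimistic (g : E -> I) m v := iter m (T (g v)) v.

Definition bellman_increasing :=
  [set v | V v /\ exists2 w, is_bellman v w & v <= w].

Definition vfi_converges := exists2 vs, is_value vs &
  forall v, bellman_increasing v ->
    increases_to V (fun n => iter n bellman v) vs.

Definition opi_converges := exists2 vs, is_value vs &
  forall g m, greedy_choice g -> (1 <= m)%N ->
  forall v, bellman_increasing v ->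
    increases_to V (fun n => iter n (optimistic g m) v) vs.

Definition hpi_converges := exists2 vs, is_value vs &
  forall g, greedy_choice g ->
  forall v, bellman_increasing v ->
    increases_to V (fun n => iter n (howard g) v) vs.

End adp.

Section path_step.
Context d (Z : measurableType d) (R : realType) (n : nat).
Variables (P : R.-pker Z ~> Z) (k : R.-pker Z ~> n.+1.-tuple Z).
Local Open Scope ereal_scope.

Definition path_cons (z : Z) (s : n.+1.-tuple Z) : n.+2.-tuple Z :=
  [the n.+2.-tuple Z of z :: s].

Let measurable_path_cons z : measurable_fun [set: n.+1.-tuple Z] (path_cons z).
Proof. exact: (@measurable_cons _ _ (n.+1.-tuple Z) Z (fun=> z) n.+1 id). Qed.

(* Law of the path zz.1 :: s when s is drawn from k zz.2. *)
Definition path_prepend (zz : Z * Z) : set (n.+2.-tuple Z) -> \bar R :=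
  pushforward (k zz.2) (path_cons zz.1).

Let path_prepend0 zz : path_prepend zz set0 = 0.
Proof. by rewrite /path_prepend /pushforward preimage_set0 measure0. Qed.

Let path_prepend_ge0 zz A : 0 <= path_prepend zz A.
Proof. exact: measure_ge0. Qed.

Let path_prepend_additive zz : semi_sigma_additive (path_prepend zz).
Proof.
pose f : {mfun n.+1.-tuple Z >-> n.+2.-tuple Z} :=
  HB.pack (path_cons zz.1)
    (isMeasurableFun.Build _ _ _ _ _ (@measurable_path_cons zz.1)).
exact: (@measure_semi_sigma_additive _ _ _ (pushforward (k zz.2) f)).
Qed.

HB.instance Definition _ zz := isMeasure.Build _ _ _ (path_prepend zz)
  (path_prepend0 zz) (path_prepend_ge0 zz) (@path_prepend_additive zz).

Definition path_prepend_kernel :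
  Z * Z -> {measure set (n.+2.-tuple Z) -> \bar R} := path_prepend.

Let measurable_path_prepend U : measurable U ->
  measurable_fun [set: Z * Z] (path_prepend_kernel ^~ U).
Proof.
move=> mU.
pose g (x : (Z * Z) * n.+1.-tuple Z) := path_cons x.1.1 x.2.
have mg : measurable_fun setT g.
  apply: (@measurable_cons _ _ ((Z * Z) * n.+1.-tuple Z)%type Z
    (fst \o fst) n.+1 snd); first exact: measurableT_comp.
  exact: measurable_snd.
have mgU : measurable (g @^-1` U).
  by rewrite -[X in measurable X]setTI; exact: mg.
have := measurable_fun_xsection_finite_kernel
  (kernel.kernel_snd k) (mem_set mgU).
by apply: eq_measurable_fun => zz _; rewrite /path_prepend /pushforward xsectionE.
Qed.

HB.instance Definition _ := isKernel.Build _ _ _ _ _ path_prepend_kernel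
  measurable_path_prepend.

Let path_prepend_setT zz : path_prepend_kernel zz setT = 1.
Proof. by rewrite /= /path_prepend /pushforward preimage_setT prob_kernel. Qed.

HB.instance Definition _ := Kernel_isProbability.Build _ _ _ _ _
  path_prepend_kernel path_prepend_setT.

(* From z, draw z' from P z, then a path s from k z'; law of z :: s. *)
Definition path_step : Z -> {measure set (n.+2.-tuple Z) -> \bar R} :=
  mkcomp P path_prepend_kernel.

Let measurable_path_step U : measurable U ->
  measurable_fun [set: Z] (path_step ^~ U).
Proof. exact: measurable_kernel. Qed.

HB.instance Definition _ := isKernel.Build _ _ _ _ _ path_step
  measurable_path_step.

Let path_step_setT z : path_step z setT = 1.
Proof.
rewrite /path_step /= /kcomp.
under eq_integral do rewrite prob_kernel.
by rewrite integral_cst// mul1e prob_kernel.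
Qed.

HB.instance Definition _ := Kernel_isProbability.Build _ _ _ _ _
  path_step path_step_setT.

End path_step.

Section markov_path.
Context d (Z : measurableType d) (R : realType).
Variable P : R.-pker Z ~> Z.
Local Open Scope ereal_scope.

Let measurable_singleton :
  measurable_fun [set: Z] (fun z => [the 1.-tuple Z of [:: z]]).
Proof. exact: (@measurable_cons _ _ Z Z id 0 (fun=> [tuple])). Qed.

Fixpoint markov_path n : R.-pker Z ~> n.+1.-tuple Z :=
  if n is m.+1 then path_step P (markov_path m) else kdirac measurable_singleton.

(* Law of (Z_0, ..., Z_n) for the Markov chain with kernel P and Z_0 = z; the
   coordinate Z_t is tnth ^~ t. *)
Definition markov_law n z : set (n.+1.-tuple Z) -> \bar R := markov_path n z.
Arguments markov_law : clear implicits.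

HB.instance Definition _ n z := Measure.on (markov_law n z).

Let markov_law_setT n z : markov_law n z setT = 1.
Proof. exact: prob_kernel. Qed.

HB.instance Definition _ n z := Measure_isProbability.Build _ _ _
  (markov_law n z) (markov_law_setT n z).

(* E_z [delta Z_1 * ... * delta Z_n]: the indices t < n are shifted by one, so
   that the factor delta Z_0 is left out. *)
Definition expected_discount (delta : Z -> R) n z : \bar R :=
  'E_(markov_law n z)[fun s => \prod_(t < n) delta (tnth s (lift ord0 t))]%R.

End markov_path.
Arguments markov_law {d Z R} P n z.

Definition bm d (X : measurableType d) (R : realType) : set (X -> R) :=
  [set v : X -> R | measurable_fun [set: X] v /\ bounded_fun v].

Definition bm_nonneg d (X : measurableType d) (R : realType) : set (X -> R) :=
  [set v | bm v /\ forall x, 0 <= v x].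

Definition bm_below d (X : measurableType d) (R : realType) (b : X -> R) :
    set (X -> R) :=
  [set v | bm v /\ forall x, 0 <= v x <= b x].

Section decision_process.
Context dY dZ dA (Y : measurableType dY) (Z : measurableType dZ)
  (A : measurableType dA) (R : realType).
Local Notation X := (Y * Z)%type.
Variables (Gamma : X -> set A) (r : X * A -> R) (P : R.-pker Z ~> Z).

(* The supremum is a constant, taken over the whole graph of Gamma. *)
Definition dominating_operator (delta : Z -> R) (Hbar : Y * Z -> Y)
    (v : X -> R) : X -> R := fun x =>
  sup [set r xa | xa in graph Gamma] +
  \int[P x.2]_z' (delta z' * v (Hbar (x.1, z'), z')).

Definition policies : set (X -> A) :=
  [set sigma | measurable_fun [set: X] sigma /\ forall x, Gamma x (sigma x)].

Definition policy_operator (beta : (X -> R) -> (X -> R)) (H : Y * A * Z -> Y)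
    (sigma : X -> A) (v : X -> R) : X -> R := fun x =>
  r (x, sigma x) + \int[P x.2]_z' (beta v (H (x.1, sigma x, z'), z')).

End decision_process.

(* Main.v *)
Require Import Defs.
From HB Require Import structures.
From mathcomp Require Import all_boot all_order all_algebra.
From mathcomp Require Import all_classical all_reals all_analysis.
From mathcomp Require Import measurable_realfun ring lra.

Set Implicit Arguments.
Unset Strict Implicit.
Unset Printing Implicit Defensive.
Import Order.TTheory GRing.Theory Num.Theory.
Import numFieldNormedType.Exports.

Local Open Scope classical_set_scope.
Local Open Scope ring_scope.

(* Subadditivity and the bound by delta make every operator involved Lipschitz
   in the weighted form |F v - F w| <= L h whenever |v - w| <= h, where
   (L h)(z) is the integral of delta * h against P z. Since L^n 1 (z) is the
   expectation of delta(Z_1) ... delta(Z_n), N5 makes each F eventually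
   contracting in the sup norm. This applies to S, to each policy operator
   T_sigma and to the Bellman operator. For S the fixed point b is found among
   the functions increasing in y, so that H <= Hbar makes T_sigma preserve
   [0, b].

   Greedy policies come from a measurable maximum theorem. For U open, the set of
   x at which some a in Gamma x and U gives r + I > c is a countable union of
   sets that are measurable by the hemicontinuity of Gamma, so the maximizers
   hit closed sets measurably. A selector is obtained by successively
   intersecting the compact set of maximizers with the members, whenever they
   are hit, of a countable family of closed sets separating points.

   The fixed point of the Bellman operator is then the greatest policy value, and
   policy iteration schemes are squeezed between it and value iteration. *)

(** * Abstract dynamic programs *)

Section abstract_dynamic_program.
Context {o : Order.disp_t} {E : porderType o} {I : Type}.
Variables (V : set E) (Sigma : set I) (T : I -> E -> E).
Local Open Scope order_scope.

Lemma lub_in_unique (B : set E) v w : lub_in V B v -> lub_in V B w -> v = w.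
Proof.
move=> [Vv Bv minv] [Vw Bw minw].
by apply: le_anti; rewrite minv// minw.
Qed.

Hypothesis adp : is_adp V Sigma T.

Let V_T s v : Sigma s -> V v -> V (T s v). Proof. by case: adp => _ + _; apply. Qed.

Let T_homo s v w : Sigma s -> V v -> V w -> v <= w -> T s v <= T s w.
Proof. by case: adp => _ _; apply. Qed.

Lemma greedy_is_bellman v s : V v -> greedy Sigma T v s ->
  is_bellman V Sigma T v (T s v).
Proof.
move=> Vv [Ss sgr]; split; [exact: V_T|by move=> _ [t St <-]; exact: sgr|].
by move=> w _; apply; exists s.
Qed.

(** A greedy policy attains the supremum and least upper bounds are unique, so under regularity the
    default value in [bellman] is never returned on [V]. *)
Lemma greedy_bellman v s : V v -> greedy Sigma T v s ->
  bellman V Sigma T v = T s v.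
Proof.
move=> Vv vs; apply: xget_unique; first exact: greedy_is_bellman.
by move=> w Bw; apply: lub_in_unique Bw (greedy_is_bellman Vv vs).
Qed.

Hypothesis T_regular : regular V Sigma T.

Local Notation bellman := (bellman V Sigma T).

Lemma V_bellman v : V v -> V (bellman v).
Proof.
move=> Vv; have [s vs] := T_regular Vv.
by rewrite (greedy_bellman Vv vs); apply: V_T => //; case: vs.
Qed.

Lemma bellman_ub v s : V v -> Sigma s -> T s v <= bellman v.
Proof.
move=> Vv Ss; have [t vt] := T_regular Vv.
by rewrite (greedy_bellman Vv vt); apply: vt.2.
Qed.

Lemma bellman_homo v w : V v -> V w -> v <= w -> bellman v <= bellman w.
Proof.
move=> Vv Vw vw; have [s vs] := T_regular Vv.
rewrite (greedy_bellman Vv vs); apply: le_trans (bellman_ub Vw vs.1).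
exact: T_homo vs.1 _ _ vw.
Qed.

Lemma bellman_increasingE v :
  bellman_increasing V Sigma T v <-> V v /\ v <= bellman v.
Proof.
split=> [[Vv [w Bw vw]]|[Vv vB]]; (split; first by []); have [s vs] := T_regular Vv.
  rewrite (greedy_bellman Vv vs).
  by rewrite (lub_in_unique (greedy_is_bellman Vv vs) Bw).
exists (T s v); first exact: greedy_is_bellman.
by rewrite -(greedy_bellman Vv vs).
Qed.

(** * Consequences of a Bellman fixed point and order stable policy operators *)

Variable vs : E.
Hypothesis V_vs : V vs.
Hypothesis bellman_vs : bellman vs = vs.
Hypothesis bellman_cvg : forall v, V v -> v <= bellman v ->
  increases_to V (fun n => iter n bellman v) vs.
Hypothesis order_stable : forall s, Sigma s ->
  exists2 vsig, is_policy_value V T s vsig &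
    forall v, V v -> (T s v <= v -> vsig <= v) /\ (v <= T s v -> v <= vsig).

(** [order_stable] speaks of one fixed point [w]; tested on [vsig], which satisfies both of its
    inequalities, it forces [vsig = w]. *)
Let policy_value_min s vsig v : Sigma s -> is_policy_value V T s vsig ->
  V v -> T s v <= v -> vsig <= v.
Proof.
move=> Ss [Vvsig fix_vsig] Vv; have [w [Vw fix_w] stab] := order_stable Ss.
have -> : vsig = w.
  by apply: le_anti; rewrite (stab _ Vvsig).1 ?(stab _ Vvsig).2 ?fix_vsig.
by case: (stab _ Vv).
Qed.

Let policy_value_max s vsig v : Sigma s -> is_policy_value V T s vsig ->
  V v -> v <= T s v -> v <= vsig.
Proof.
move=> Ss [Vvsig fix_vsig] Vv; have [w [Vw fix_w] stab] := order_stable Ss.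
have -> : vsig = w.
  by apply: le_anti; rewrite (stab _ Vvsig).1 ?(stab _ Vvsig).2 ?fix_vsig.
by case: (stab _ Vv).
Qed.

Lemma order_stable_unique s v w :
  Sigma s -> is_policy_value V T s v -> is_policy_value V T s w -> v = w.
Proof.
move=> Ss sv sw; apply: le_anti; apply/andP; split.
  by apply: (policy_value_min Ss sv); [exact: sw.1|rewrite sw.2].
by apply: (policy_value_min Ss sw); [exact: sv.1|rewrite sv.2].
Qed.

Let T_wp : well_posed V Sigma T.
Proof.
move=> s Ss; have [w sw _] := order_stable Ss.
by exists w; split=> // v; exact: order_stable_unique.
Qed.

(** As [bellman] fixes [vs], a policy attains the maximum at [vs] exactly when its operator fixes
    [vs]. Greediness and optimality are then compared through this one equation. *)
Lemma greedy_vsP s : greedy Sigma T vs s <-> Sigma s /\ is_policy_value V T s vs.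
Proof.
split=> [gs|[Ss [_ fix_vs]]].
  by split; [exact: gs.1|split; rewrite // -(greedy_bellman V_vs gs)].
by split=> // t St; rewrite fix_vs -[leRHS]bellman_vs; exact: bellman_ub.
Qed.

Lemma vs_policy_values : policy_values V Sigma T vs.
Proof.
by have [s /greedy_vsP[]] := T_regular V_vs; exists s.
Qed.

(** Each policy operator satisfies [T s vs <= bellman vs = vs], and order stability turns this into
    a bound on its fixed point. *)
Lemma policy_values_ub : ubound (policy_values V Sigma T) vs.
Proof.
move=> v [s Ss sv]; apply: (policy_value_min Ss sv) => //.
by rewrite -[leRHS]bellman_vs; exact: bellman_ub.
Qed.

Lemma is_value_vs : is_value V Sigma T vs.
Proof.
split=> //; first exact: policy_values_ub.
by move=> w _; apply; exact: vs_policy_values.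
Qed.

Lemma is_valueE w : is_value V Sigma T w -> w = vs.
Proof. by move=> /lub_in_unique; apply; exact: is_value_vs. Qed.

Lemma optimalE s : optimal V Sigma T s <-> greedy Sigma T vs s.
Proof.
rewrite greedy_vsP; split=> [[Ss [v sv vub]]|[Ss svs]].
  split=> //; suff <- : v = vs by [].
  apply: le_anti; rewrite (vub _ vs_policy_values) policy_values_ub//.
  by exists s.
by split=> //; exists vs => //; exact: policy_values_ub.
Qed.

Lemma fundamental_optimality_of_stable : fundamental_optimality V Sigma T.
Proof.
split=> //.
- by have [s /optimalE] := T_regular V_vs; exists s.
- have Bvs : is_bellman V Sigma T vs vs.
    have [s gs] := T_regular V_vs; have := greedy_is_bellman V_vs gs.
    by rewrite -(greedy_bellman V_vs gs) bellman_vs.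
  exists vs; split=> //; first exact: is_value_vs.
  move=> v [Vv Bv].
  have fix_v : bellman v = v.
    by apply: xget_unique => // w; move/lub_in_unique; exact.
  (* The value iterates from a solution [v] are constantly [v] and yet increase to [vs], which gives
     [v = vs]. *)
  have [|_ [_ ub_vs min_vs]] := bellman_cvg Vv; first by rewrite fix_v.
  have iter_v n : iter n bellman v = v by elim: n => //= n ->.
  apply: le_anti; rewrite min_vs ?andbT// => [|_ [n _ <-]]; last by rewrite iter_v.
  by apply: ub_vs; exists 0%N.
- split=> // s; rewrite optimalE; split=> [gs|[w /is_valueE -> //]].
  by exists vs => //; exact: is_value_vs.
Qed.

Lemma vfi_of_stable : vfi_converges V Sigma T.
Proof.
exists vs; first exact: is_value_vs.
by move=> v /bellman_increasingE[]; exact: bellman_cvg.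
Qed.

Lemma bellman_increasing_le_vs v : V v -> v <= bellman v -> v <= vs.
Proof.
move=> Vv vB; have [_ [_ ub_vs _]] := bellman_cvg Vv vB.
by apply: ub_vs; exists 0%N.
Qed.

(* An improvement operator squeezed between one Bellman step and the value
   function inherits the convergence of value function iteration. *)
Lemma improvement_cvg (W : E -> E) :
  (forall v, V v -> v <= bellman v ->
    [/\ V (W v), W v <= bellman (W v) & bellman v <= W v]) ->
  forall v, V v -> v <= bellman v -> increases_to V (fun n => iter n W v) vs.
Proof.
move=> HW v Vv vB.
have iterW n : V (iter n W v) /\ iter n W v <= bellman (iter n W v).
  by elim: n => [//|n [Vn nB]]; have [] := HW _ Vn nB.
have VB n : V (iter n bellman v).
  by elim: n => [//|n]; exact: V_bellman.
have BW n : iter n bellman v <= iter n W v.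
  elim: n => [//|n IHn]; have [Vn nB] := iterW n.
  have [_ _ /= BWn] := HW _ Vn nB.
  exact: le_trans (bellman_homo _ _ IHn) BWn.
split=> [n|].
  have [Vn nB] := iterW n; have [_ _ /=] := HW _ Vn nB.
  exact: le_trans.
split=> // [_ [n _ <-]|w Vw ubw].
  by have [Vn nB] := iterW n; exact: bellman_increasing_le_vs.
have [_ [_ _]] := bellman_cvg Vv vB; apply=> // _ [n _ <-].
by apply: le_trans (BW n) _; apply: ubw; exists n.
Qed.

(** From [v <= T (g v) v] the iterates of the greedy operator increase. Since [1 <= m], the last one
    lies above the first, which is [bellman v]. *)
Lemma opi_of_stable : opi_converges V Sigma T.
Proof.
exists vs => [|g m gV m1 v]; first exact: is_value_vs.
move=> /bellman_increasingE[Vv vB].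
apply: improvement_cvg Vv vB => {}v Vv vB.
have gv := gV _ Vv; have Sg := gv.1.
have vT : v <= T (g v) v by rewrite -(greedy_bellman Vv gv).
have VT n : V (iter n (T (g v)) v) by elim: n => //= n; exact: V_T.
have Tincr n : iter n (T (g v)) v <= T (g v) (iter n (T (g v)) v).
  by elim: n => //= n IHn; apply: T_homo => //; exact: VT n.+1.
split; first exact: VT.
  by apply: le_trans (Tincr m) _; exact: bellman_ub.
rewrite (greedy_bellman Vv gv) /optimistic; case: m m1 => // m _.
elim: m => [//|m IHm]; exact: le_trans IHm (Tincr _).
Qed.

(** Order stability lifts [v <= T (g v) v] to [v <= w], where [w] is the value of the greedy policy;
    applying the operator once more gives [bellman v <= w]. *)
Lemma hpi_of_stable : hpi_converges V Sigma T.
Proof.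
exists vs => [|g gV v]; first exact: is_value_vs.
move=> /bellman_increasingE[Vv vB].
apply: improvement_cvg Vv vB => {}v Vv vB.
have gv := gV _ Vv; have Sg := gv.1.
have vT : v <= T (g v) v by rewrite -(greedy_bellman Vv gv).
have [w [gw _]] := T_wp Sg.
have -> : howard V T g v = w.
  by apply: xget_unique => [//|u gu]; exact: (order_stable_unique Sg gu gw).
split; first exact: gw.1.
  by rewrite -[leLHS]gw.2; apply: bellman_ub; first exact: gw.1.
rewrite (greedy_bellman Vv gv) -[leRHS]gw.2; apply: T_homo => //; first exact: gw.1.
exact: (policy_value_max Sg gw).
Qed.

End abstract_dynamic_program.

(** * Eventual contractions in the sup norm *)

Section contraction.
Context {X : Type} {R : realType}.
Implicit Types (v w : X -> R) (K : R) (V : set (X -> R)).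

Definition uniformly_within K v w := forall x, `|v x - w x| <= K.

Lemma uniformly_within_sym K v w :
  uniformly_within K v w -> uniformly_within K w v.
Proof. by move=> vw x; rewrite distrC. Qed.

Lemma uniformly_within_trans K1 K2 u v w : uniformly_within K1 u v ->
  uniformly_within K2 v w -> uniformly_within (K1 + K2) u w.
Proof. by move=> uv vw x; rewrite (le_trans (ler_distD (v x) _ _))// lerD. Qed.

Lemma uniformly_within_cvg (g : nat -> R) (u : nat -> X -> R) v x :
  g @ \oo --> 0 -> (forall n, uniformly_within (g n) (u n) v) ->
  u n x @[n --> \oo] --> v x.
Proof.
move=> g0 uv; apply/cvgrPdist_le => e e0.
move/cvgrPdist_le : g0 => /(_ e e0); apply: filterS => n.
rewrite sub0r normrN => gne; rewrite distrC (le_trans (uv n x))//.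
by rewrite (le_trans _ gne)// ler_norm.
Qed.

Lemma uniformly_within_eq (g : nat -> R) v w :
  g @ \oo --> 0 -> (forall n, uniformly_within (g n) v w) -> v = w.
Proof.
move=> g0 vw; apply/funext => x.
have vwx := @uniformly_within_cvg g (fun=> v) w x g0 vw.
exact: norm_cvg_unique (cvg_cst (v x)) vwx.
Qed.

Definition uniformly_closed V := forall (g : nat -> R) (u : nat -> X -> R) v,
  g @ \oo --> 0 -> (forall n, V (u n)) ->
  (forall n, uniformly_within (g n) (u n) v) -> V v.

(* The limit is the supremum of u n - g n, so no completeness of a function
   space is involved. *)
Lemma uniformly_cauchy_cvg (g : nat -> R) (u : nat -> X -> R) :
  (forall m n, uniformly_within (g m + g n) (u m) (u n)) ->
  exists v, forall n, uniformly_within (g n) (u n) v.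
Proof.
move=> ug; pose B x := range (fun n => u n x - g n).
have ubB x n : ubound (B x) (u n x + g n).
  move=> _ [m _ <-]; have := le_trans (ler_norm _) (ug m n x); lra.
exists (fun x => sup (B x)) => n x; rewrite ler_distlC; apply/andP; split.
  by apply: ub_le_sup; [exists (u 0%N x + g 0%N)|exists n].
by apply: ge_sup => //; exists (u 0%N x - g 0%N); exists 0%N.
Qed.

(** * Fixed points of a map whose iterates have Lipschitz constants tending to zero *)

Variables (V : set (X -> R)) (F : (X -> R) -> X -> R) (c : nat -> R).
Hypothesis F_V : forall v, V v -> V (F v).
Hypothesis c_ge0 : forall n, 0 <= c n.
Hypothesis c_cvg0 : c @ \oo --> 0.
Hypothesis F_within : forall n v w K, V v -> V w -> 0 <= K ->
  uniformly_within K v w ->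
  uniformly_within (c n * K) (iter n F v) (iter n F w).
Hypothesis V_within : forall v w, V v -> V w ->
  exists2 K, 0 <= K & uniformly_within K v w.

Lemma iter_contraction_stable v n : V v -> V (iter n F v).
Proof. by move=> Vv; elim: n => //= n; exact: F_V. Qed.

Let cK_cvg0 K : c n * K @[n --> \oo] --> 0.
Proof. by rewrite -[X in _ --> X](mul0r K); apply: cvgMr_tmp. Qed.

Lemma contraction_fixpoint_cvg v w x : V v -> F v = v -> V w ->
  iter n F w x @[n --> \oo] --> v x.
Proof.
move=> Vv fix_v Vw; have [K K0 wv] := V_within Vw Vv.
apply: (@uniformly_within_cvg (fun n => c n * K)) => [|n]; first exact: cK_cvg0.
suff <- : iter n F v = v by exact: F_within.
by elim: n => //= n ->.
Qed.

Lemma contraction_fixpoint_unique v w :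
  V v -> F v = v -> V w -> F w = w -> v = w.
Proof.
move=> Vv fix_v Vw fix_w; apply/funext => x.
have := @contraction_fixpoint_cvg _ _ x Vv fix_v Vw.
have iter_w n : iter n F w = w by elim: n => //= n ->.
by under eq_fun do rewrite iter_w; move/norm_cvg_unique => /(_ _ (cvg_cst _)).
Qed.

(** Some iterate [G] of [F] halves distances, so its orbit [e] is bounded, and hence Cauchy because
    [c] vanishes. The limit is fixed by [F] itself, since [F] almost fixes [e m] for large [m]. *)
Lemma contraction_fixpoint_ex : uniformly_closed V -> V !=set0 ->
  exists2 v, V v & F v = v.
Proof.
move=> V_closed [v0 Vv0].
(* Positivity of [N] is what makes [m * N] tend to infinity below. *)
have [N [N0 cN]] : exists N, (0 < N)%N /\ c N <= 2^-1.
  have /cvgrPdist_le/(_ 2^-1) := c_cvg0.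
  rewrite invr_gt0 ltr0n => /(_ isT)[N _ /(_ N.+1)].
  rewrite /= leqnSn sub0r normrN => /(_ isT) cN.
  by exists N.+1; split=> //; rewrite (le_trans (ler_norm _)).
have [K K0 hK] := V_within (iter_contraction_stable N Vv0) Vv0.
pose G := iter N F; pose e m := iter m G v0.
have eE m : e m = iter (m * N) F v0 by rewrite iterM.
have Ve m : V (e m) by rewrite eE; exact: iter_contraction_stable.
(* The radius [2 * K] is stable: [G] halves it to [K], and [G] moves [v0] by at most [K]. *)
have e_bounded m : uniformly_within (2 * K) (e m) v0.
  elim: m => [|m IHm] x; first by rewrite subrr normr0 mulr_ge0.
  have : uniformly_within (K + K) (e m.+1) v0.
    apply: uniformly_within_trans hK => y.
    have := F_within N (Ve m) Vv0 _ IHm y; rewrite mulr_ge0// => /(_ isT).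
    move=> /le_trans; apply; rewrite mulrA ler_piMl//.
    by rewrite -(ler_pM2r (_ : 0 < 2^-1 :> R)) ?mulfK ?mul1r.
  by move=> /(_ x); rewrite mulr_natl mulr2n.
pose g m := c (m * N)%N * (2 * K).
have g_ge0 m : 0 <= g m by rewrite !mulr_ge0.
have cN_cvg0 : c (m * N)%N @[m --> \oo] --> 0.
  apply: (@cvg_comp _ _ _ (fun m => m * N)%N c _ \oo) => //.
  exact: cvg_mulnr.
have g_cvg0 : g @ \oo --> 0.
  by rewrite -[X in _ --> X](mul0r (2 * K)); apply: cvgMr_tmp.
have e_shift m k : uniformly_within (g m) (e (m + k)%N) (e m).
  rewrite /e iterD -[iter m G (iter k G v0)]iterM -[iter m G v0]iterM.
  by apply: F_within; rewrite ?mulr_ge0//; [exact: Ve|exact: e_bounded].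
have [v ev] : exists v, forall n, uniformly_within (g n) (e n) v.
  apply: uniformly_cauchy_cvg => m n x.
  have [mn|/ltnW mn] := leqP m n.
    rewrite -(subnKC mn) distrC (le_trans (e_shift _ _ _))//.
    by rewrite lerDl.
  by rewrite -(subnKC mn) (le_trans (e_shift _ _ _))// lerDr.
have Vv : V v by exact: V_closed g_cvg0 Ve ev.
exists v => //.
have [K1 K10 hK1] := V_within (F_V Vv0) Vv0.
(* The three errors separate [F v], [F (e m)], [e m] and [v]; the middle one compares the orbits of
   [F v0] and [v0] after [m * N] steps. *)
apply: (@uniformly_within_eq (fun m => c 1%N * g m + c (m * N)%N * K1 + g m)).
  rewrite -[X in _ --> X](addr0 0); apply: cvgD => //.
  rewrite -[X in _ --> X](addr0 0); apply: cvgD => //.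
    by rewrite -[X in _ --> X](mulr0 (c 1%N)); apply: cvgMl_tmp.
  by rewrite -[X in _ --> X](mul0r K1); apply: cvgMr_tmp.
move=> m; apply: uniformly_within_trans (ev m).
apply: (@uniformly_within_trans _ _ _ (F (e m))).
  by apply: (F_within 1) => //; apply: uniformly_within_sym.
by rewrite eE -iterS iterSr; apply: F_within => //; exact: F_V.
Qed.

End contraction.

(** * Discounting along the Markov chain *)

Section bounded_measurable.
Context d (X : measurableType d) (R : realType).
Implicit Types f g : X -> R.

Lemma bounded_funE (T : Type) (f : T -> R) :
  bounded_fun f <-> exists2 M, 0 <= M & forall x, `|f x| <= M.
Proof.
split=> [[M [_ fM]]|[M M0 fM]].
  exists (`|M| + 1) => [|x]; first by rewrite addr_ge0.
  by apply: fM => //; rewrite ltr_pwDr// ler_norm.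
exists M; split; first exact: ger0_real.
by move=> K MK x _; exact: le_trans (fM x) (ltW MK).
Qed.

Lemma bm_cst (k : R) : bm (cst k : X -> R).
Proof.
split; first exact: measurable_cst.
by apply/bounded_funE; exists `|k|.
Qed.

Lemma bmD f g : bm f -> bm g -> bm (f \+ g).
Proof.
move=> [mf /bounded_funE[M M0 fM]] [mg /bounded_funE[N N0 gN]]; split.
  exact: measurable_funD.
apply/bounded_funE; exists (M + N) => [|x]; first exact: addr_ge0.
by rewrite (le_trans (ler_normD _ _))// lerD.
Qed.

Lemma bmM f g : bm f -> bm g -> bm (f \* g).
Proof.
move=> [mf /bounded_funE[M M0 fM]] [mg /bounded_funE[N N0 gN]]; split.
  exact: measurable_funM.
apply/bounded_funE; exists (M * N) => [|x]; first exact: mulr_ge0.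
by rewrite normrM ler_pM.
Qed.

Lemma bmB f g : bm f -> bm g -> bm (f \- g).
Proof.
move=> fm [mg gb].
rewrite (_ : f \- g = f \+ (cst (-1) \* g)); last first.
  by apply/funext => x /=; rewrite mulN1r.
by apply: bmD => //; apply: bmM => //; exact: bm_cst.
Qed.

Lemma bm_norm f : bm f -> bm (fun x => `|f x|).
Proof.
move=> [mf /bounded_funE[M M0 fM]]; split; first exact: measurableT_comp.
by apply/bounded_funE; exists M => // x; rewrite normr_id.
Qed.

Lemma bm_comp d' (X' : measurableType d') (g : X' -> X) f :
  measurable_fun setT g -> bm f -> bm (f \o g).
Proof.
move=> mg [mf /bounded_funE[M M0 fM]]; split; first exact: measurableT_comp.
by apply/bounded_funE; exists M => // x; exact: fM.
Qed.

Lemma bm_uniformly_closed : uniformly_closed (@bm d X R).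
Proof.
move=> g u v g0 bmu uv; split.
  apply: (@measurable_fun_cvg _ _ _ _ u) => [n|x _]; first by have [] := bmu n.
  exact: uniformly_within_cvg uv.
have [_ /bounded_funE[M M0 uM]] := bmu 0%N.
apply/bounded_funE; exists (M + `|g 0%N|) => [|x]; first exact: addr_ge0.
rewrite -[v x](addrNK (u 0%N x)) addrC (le_trans (ler_normD _ _))// lerD//.
by rewrite distrC (le_trans (uv 0%N x))// ler_norm.
Qed.

Lemma bm_within f g : bm f -> bm g ->
  exists2 K, 0 <= K & uniformly_within K f g.
Proof.
move=> [_ /bounded_funE[M M0 fM]] [_ /bounded_funE[N N0 gN]].
exists (M + N) => [|x]; first exact: addr_ge0.
by rewrite (le_trans (ler_normB _ _))// lerD.
Qed.

End bounded_measurable.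

Section kernel_integral.
Context d d' (X : measurableType d) (Z : measurableType d') (R : realType).
Variable P : R.-pker Z ~> Z.

Lemma bm_integrable (f : Z -> R) z : bm f -> (P z).-integrable setT (EFin \o f).
Proof.
move=> [mf bf]; apply: measurable_bounded_integrable => //.
by rewrite prob_kernel ltry.
Qed.

Lemma le_kernel_integral (f g : Z -> R) z : bm f -> bm g ->
  (forall z', f z' <= g z') -> \int[P z]_z' f z' <= \int[P z]_z' g z'.
Proof. by move=> bf bg fg; apply: le_Rintegral => //; exact: bm_integrable. Qed.

Lemma kernel_integral_cst (k : R) z : \int[P z]_z' k = k.
Proof. by rewrite Rintegral_cst// prob_kernel mulr1. Qed.

Lemma kernel_integralB (f g : Z -> R) z : bm f -> bm g ->
  \int[P z]_z' (f z' - g z') = \int[P z]_z' f z' - \int[P z]_z' g z'.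
Proof. by move=> bf bg; apply: RintegralB => //; exact: bm_integrable. Qed.

Lemma normr_kernel_integral (f g : Z -> R) z : bm f -> bm g ->
  (forall z', `|f z'| <= g z') -> `|\int[P z]_z' f z'| <= \int[P z]_z' g z'.
Proof.
move=> bf bg fg; apply: (le_trans (le_normr_Rintegral _ _)) => //.
  exact: bm_integrable.
by apply: le_kernel_integral => //; exact: bm_norm.
Qed.

(** Lifting [P] to a kernel on [X * Z] that ignores the first coordinate makes the integral
    measurable in the parameter and the state; it is then composed with [k]. Nonnegativity places
    the integrand in the scope of kernel integration. *)
Lemma kernel_integral_bm (f : X * Z -> R) (g : X -> Z) : bm_nonneg f ->
  measurable_fun setT g -> bm (fun x => \int[P (g x)]_z' f (x, z')).
Proof.
move=> [[mf fb] f0] mg; split.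
  pose h (xzz : X * Z * Z) := (f (xzz.1.1, xzz.2))%:E.
  have mh : measurable_fun setT h.
    apply/measurable_EFinP; apply: measurableT_comp => //.
    by apply: measurable_fun_pair => //; exact: measurableT_comp.
  pose l := @kernel.kernel_snd _ _ _ X Z Z R P.
  have ml := @measurable_fun_integral_finite_kernel _ _ _ _ _ h l.
  have /(_ _ mh) := ml; rewrite /h => {}ml.
  pose k (x : X) := (x, g x).
  have mk : measurable_fun setT k by exact: measurable_fun_pair.
  apply: (@measurableT_comp _ _ _ _ _ _ fine) => //.
  apply: (@measurableT_comp _ _ _ _ _ _ _ _ k (ml _) mk) => z.
  by rewrite lee_fin.
have /bounded_funE[M M0 fM] := fb.
apply/bounded_funE; exists M => // x; rewrite -[leRHS](kernel_integral_cst M (g x)).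
apply: normr_kernel_integral; last by move=> z'; exact: fM.
  apply: (@bm_comp _ _ _ _ _ (fun z' => (x, z')) f) => //.
  exact: measurable_pair1.
exact: bm_cst.
Qed.

End kernel_integral.

(** * The discounted transition operator and its iterates as path expectations *)

Section discount_kernel.
Context d (Z : measurableType d) (R : realType).
Variables (P : R.-pker Z ~> Z) (delta : Z -> R).
Hypothesis delta_ge0 : forall z, 0 <= delta z.
Hypothesis delta_bm : bm delta.

Definition discounted (h : Z -> R) z := \int[P z]_z' (delta z' * h z').

Lemma discounted_ge0 h : (forall z, 0 <= h z) -> forall z, 0 <= discounted h z.
Proof. by move=> h0 z; apply: Rintegral_ge0 => z' _; exact: mulr_ge0. Qed.

Lemma discounted_bm h : bm_nonneg h -> bm (discounted h).
Proof.
move=> [bh h0].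
apply: (@kernel_integral_bm _ _ Z Z R P (fun zz => delta zz.2 * h zz.2) id) => //.
split=> [|zz]; last exact: mulr_ge0.
apply: (@bm_comp _ _ _ _ _ snd (delta \* h)); first exact: measurable_snd.
exact: bmM.
Qed.

Lemma iter_discounted_nonneg h n : bm_nonneg h -> bm_nonneg (iter n discounted h).
Proof.
move=> bh; elim: n => [//|n IHn]; split; first exact: discounted_bm.
by apply: discounted_ge0; case: IHn.
Qed.

Lemma discountedZ k h : bm h ->
  discounted (fun z => k * h z) = (fun z => k * discounted h z).
Proof.
move=> bh; apply/funext => z; rewrite /discounted -RintegralZl//; last first.
  by apply: bm_integrable; exact: bmM.
by apply: eq_Rintegral => z' _; rewrite mulrCA.
Qed.

Lemma iter_discounted_cst k n z :
  iter n discounted (cst k) z = k * iter n discounted (cst 1) z.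
Proof.
suff -> : iter n discounted (cst k) =
    (fun z => k * iter n discounted (cst 1) z) by [].
elim: n => [|n IHn]; first by apply/funext => ? /=; rewrite mulr1.
rewrite !iterS IHn discountedZ//.
by apply: (iter_discounted_nonneg n _).1; split=> [|?]; [exact: bm_cst|].
Qed.

Local Open Scope ereal_scope.

Let measurable_path_cons n z :
  measurable_fun [set: n.+1.-tuple Z] (@path_cons _ Z n z).
Proof. exact: (@measurable_cons _ _ (n.+1.-tuple Z) Z (fun=> z) n.+1 id). Qed.

(** Conditioning on the first transition: the path law is the composition of [P] with a kernel of
    pushforwards under [path_cons z]. *)
Lemma ge0_integral_markov_path (n : nat) z (f : n.+2.-tuple Z -> \bar R) :
  measurable_fun setT f -> (forall s, 0 <= f s) ->
  \int[markov_path P n.+1 z]_s f s =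
  \int[P z]_z' \int[markov_path P n z']_s f (path_cons z s).
Proof.
move=> mf f0.
rewrite -[LHS]/(\int[kcomp P (path_prepend_kernel (markov_path P n)) z]_s f s).
rewrite integral_kcomp//; apply: eq_integral => z' _.
rewrite -[LHS]/(\int[pushforward (markov_path P n z') (path_cons z)]_s f s).
rewrite ge0_integral_pushforward//.
exact: measurable_path_cons.
Qed.

(** The chain starts at [z] surely, so a factor depending on the head alone is constant. *)
Lemma ge0_integral_markov_path_head n z (h : Z -> R)
    (f : n.+1.-tuple Z -> \bar R) :
  measurable_fun setT h -> (forall z, 0 <= h z)%R ->
  measurable_fun setT f -> (forall s, 0 <= f s) ->
  \int[markov_path P n z]_s ((h (thead s))%:E * f s) =
  (h z)%:E * \int[markov_path P n z]_s f s.
Proof.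
move=> mh h0 mf f0.
have mhf : measurable_fun setT (fun s : n.+1.-tuple Z => (h (thead s))%:E * f s).
  apply: emeasurable_funM => //; apply/measurable_EFinP.
  by apply: measurableT_comp => //; exact: measurable_tnth.
have hf0 s : 0 <= (h (thead s))%:E * f s by rewrite mule_ge0// lee_fin.
case: n f mf f0 mhf hf0 => [|n] f mf f0 mhf hf0.
  rewrite -[LHS]/(\int[\d_([the 1.-tuple Z of [:: z]])]_s ((h (thead s))%:E * f s)).
  rewrite integral_dirac// diracT mul1e; congr (_ * _).
  rewrite -[RHS]/(\int[\d_([the 1.-tuple Z of [:: z]])]_s f s).
  by rewrite integral_dirac// diracT mul1e.
rewrite !ge0_integral_markov_path//.
have mcons : measurable_fun setT (fun s => f (path_cons z s)).
  apply: measurableT_comp => //.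
  exact: measurable_path_cons.
under eq_integral => z' _.
  rewrite [X in \int[_]_s X s](_ : _ = fun s =>
    (h z)%:E * f (path_cons z s)); last first.
    by apply/funext => s; rewrite theadE.
  rewrite ge0_integralZl//; last by rewrite lee_fin.
  over.
rewrite ge0_integralZl// ?lee_fin//.
- apply: measurable_fun_integral_kernel => // U mU; exact: measurable_kernel.
- by move=> z' _; exact: integral_ge0.
Qed.

(** Induction on the horizon, conditioning on the first new state [z']: the factor [delta z']
    belongs to the head of the path restarted at [z'], and the other factors form the same product
    with one term fewer. *)
Lemma expected_discountE n z :
  expected_discount P delta n z = (iter n discounted (cst 1%R) z)%:E.
Proof.
have mprod m : measurable_fun setT (fun s : m.+1.-tuple Z =>
    (\prod_(t < m) delta (tnth s (lift ord0 t)))%R).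
  apply: measurable_prod => t _; apply: measurableT_comp; first by case: delta_bm.
  exact: measurable_tnth.
rewrite /expected_discount unlock.
rewrite -[LHS]/(\int[markov_path P n z]_s
  (\prod_(t < n) delta (tnth s (lift ord0 t)))%R%:E).
elim: n z => [|n IHn] z.
  under eq_integral do rewrite big_ord0.
  by rewrite integral_cst// mul1e prob_kernel.
rewrite ge0_integral_markov_path; last 2 first.
- by apply/measurable_EFinP; exact: mprod.
- by move=> s; rewrite lee_fin prodr_ge0.
transitivity (\int[P z]_z' (delta z' * iter n discounted (cst 1%R) z')%:E).
  apply: eq_integral => z' _.
  rewrite EFinM -IHn -ge0_integral_markov_path_head//; last 3 first.
  - by case: delta_bm.
  - by apply/measurable_EFinP; exact: mprod.
  - by move=> s; rewrite lee_fin prodr_ge0.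
  apply: eq_integral => s _; rewrite -EFinM; congr (_%:E).
  rewrite big_ord_recl; congr (_ * _)%R.
    by rewrite /thead !(tnth_nth z).
  by apply: eq_bigr => t _; rewrite !(tnth_nth z).
rewrite /= /discounted /Rintegral fineK//.
apply: integrable_fin_num => //; apply: bm_integrable; apply: bmM => //.
by apply: (iter_discounted_nonneg n _).1; split=> [|?]; [exact: bm_cst|].
Qed.

End discount_kernel.

(** * Measurable selection from compact-valued correspondences *)

Definition nat_basis {T : topologicalType} (B : nat -> set T) :=
  (forall n, open (B n)) /\
  forall a U, nbhs a U -> exists n, B n a /\ B n `<=` U.

(** Take balls of radius [2 * r k] about dense points, replaced by their interiors because balls
    need not be open. A dense point within [r k] of [a] then yields a basis element containing [a]
    and inside [ball a (3 * r k)]. *)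
Lemma separable_nat_basis (R : realType) (T : pseudoPMetricType R) :
  separable T -> exists B : nat -> set T, nat_basis B.
Proof.
move=> [D /pcard_geP[e] D_dense].
pose r k : R := k.+1%:R^-1.
pose B n : set T :=
  if unpickle n is Some (i, k) then (ball (e i) (r k + r k))^° else set0.
have r_gt0 k : 0 < r k by rewrite invr_gt0.
exists B; split=> [n|a U].
  rewrite /B; case: unpickle => [[i k]|]; [exact: open_interior|exact: open0].
move=> /nbhs_ballP[eps /= eps0 epsU].
have [k rk] : exists k, 3 * r k < eps.
  have eps30 : 0 < eps / 3 by rewrite divr_gt0.
  have [k _ /(_ k)] := near_infty_natSinv_lt (PosNum eps30).
  rewrite /= leqnn => /(_ isT) rk; exists k.
  by rewrite mulrC -ltr_pdivlMr.
have [b [abk Db]] : exists b, (ball a (r k))^° b /\ D b.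
  have [||b [? ?]] := D_dense (ball a (r k))^°; last by exists b.
  - by exists a; apply: nbhsx_ballx.
  - exact: open_interior.
have {}abk : ball a (r k) b by exact: interior_subset abk.
have [i _ eib] := @surj _ _ _ _ e b Db.
exists (pickle (i, k)); rewrite /B pickleK eib; split.
  have : nbhs a (ball a (r k)) by exact: nbhsx_ballx.
  apply: filterS => c; apply: ball_triangle; exact: ball_sym.
move=> c /interior_subset bc; apply: epsU.
apply: le_ball (ltW rk) _ _.
rewrite (_ : 3 * r k = r k + (r k + r k)); last by ring.
exact: ball_triangle bc.
Qed.

(** By the Hausdorff property some neighbourhood of [a] has a closure that misses [b]; any basis
    element inside it inherits this. *)
Lemma nat_basis_separating (R : realType) (T : metricType R) (B : nat -> set T) :
  nat_basis B -> forall a b : T, a <> b ->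
  exists n, closure (B n) a /\ ~ closure (B n) b.
Proof.
move=> [_ B_nbhs] a b ab.
have [U /= aU clUb] : exists2 U, nbhs a U & ~ closure U b.
  apply: contrapT => /forall2NP nab; apply: ab.
  apply: (@metric_hausdorff R T) => U V aU bV.
  by case: (nab U) => // /contrapT; apply.
have [n [Bna BnU]] := B_nbhs _ _ aU.
exists n; split; first exact: subset_closure.
by apply: contra_not clUb; apply: closure_subset.
Qed.

(** A sequence picked from the sets has a cluster point in [K 0], and it is eventually in each
    closed [K n]. *)
Lemma nested_compact_nonempty (T : topologicalType) (K : nat -> set T) :
  compact (K 0%N) ->
  (forall n, closed (K n)) -> (forall n, K n !=set0) ->
  (forall n, K n.+1 `<=` K n) -> (\bigcap_n K n) !=set0.
Proof.
move=> K0_compact K_closed /choice[u Ku] K_decr.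
have K_le m n : (m <= n)%N -> K n `<=` K m.
  move=> /subnKC <-; elim: (n - m)%N => [|k IHk]; first by rewrite addn0.
  by rewrite addnS; apply: subset_trans IHk; exact: K_decr.
have K_near m : \forall n \near \oo, K m (u n).
  by exists m => // n /= mn; apply: K_le mn _ _.
have [p [_ up]] := K0_compact (u @ \oo) _ (K_near 0%N).
exists p => n _; apply: K_closed => V pV.
have := up _ _ (K_near n) pV.
by rewrite setIC.
Qed.

Section measurable_selection.
Context d (X : measurableType d) {T : topologicalType}.
Implicit Type K : X -> set T.

(** Measurability of a correspondence in the strong sense, through lower inverses of closed sets. *)
Definition hit_measurable K := forall F, closed F ->
  measurable [set x | K x `&` F !=set0].

Hypothesis T_hausdorff : hausdorff_space T.
Variable C : nat -> set T.
Hypothesis C_closed : forall n, closed (C n).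
Hypothesis C_separating : forall a b, a <> b -> exists n, C n a /\ ~ C n b.
Variable K : X -> set T.
Hypothesis K_compact : forall x, compact (K x).
Hypothesis K_nonempty : forall x, K x !=set0.
Hypothesis K_hit : hit_measurable K.

(** The implication encodes a case distinction: intersect with [C n] where the result is nonempty,
    change nothing elsewhere. *)
Let shrink (L : X -> set T) n x :=
  [set a | L x a /\ (L x `&` C n !=set0 -> C n a)].

Fixpoint shrunk n : X -> set T :=
  if n is m.+1 then shrink (shrunk m) m else K.

Let shrink_eq L n x : shrink L n x = L x `&` C n \/
  ~ (L x `&` C n !=set0) /\ shrink L n x = L x.
Proof.
have [h|h] := pselect (L x `&` C n !=set0); [left|right; split=> //];
  by apply/seteqP; split=> a; rewrite /shrink /=; tauto.
Qed.

Let shrunk_closed n x : closed (shrunk n x).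
Proof.
elim: n => [|n IHn] /=; first exact: compact_closed.
by case: (shrink_eq (shrunk n) n x) => [->|[_ ->]//]; exact: closedI.
Qed.

Let shrunk_nonempty n x : shrunk n x !=set0.
Proof.
elim: n => [|n [a na]] //=.
have [[b [nb Cb]]|h] := pselect (shrunk n x `&` C n !=set0); first by exists b.
by exists a.
Qed.

Let shrunk_decr n x : shrunk n.+1 x `<=` shrunk n x.
Proof. by move=> a []. Qed.

Let shrunk_hit n : hit_measurable (shrunk n).
Proof.
elim: n => [|n IHn] //= F F_closed.
rewrite (_ : [set x | _] = [set x | shrunk n x `&` (C n `&` F) !=set0] `|`
   ([set x | shrunk n x `&` F !=set0] `\` [set x | shrunk n x `&` C n !=set0])).
  apply: measurableU; first by apply: IHn; exact: closedI.
  by apply: measurableD; exact: IHn.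
apply/seteqP; split=> x /=.
  move=> [a [[na Ca] Fa]].
  have [h|h] := pselect (shrunk n x `&` C n !=set0); last first.
    by right; split=> //; exists a.
  by left; exists a; split=> //; split=> //; exact: Ca.
move=> [[a [na [Ca Fa]]]|[[a [na Fa]] h]]; first by exists a.
by exists a.
Qed.

(** Compactness keeps the intersection of the shrunk sets nonempty. It is a single point: if [C n]
    contains one of two points, stage [n] cuts down to [C n] and loses the other. The same
    compactness, relative to [F], shows that this point is in [F] once all stages hit [F]. *)
Lemma compact_measurable_selection : exists sigma : X -> T,
  (forall x, K x (sigma x)) /\
  forall F, closed F -> measurable (sigma @^-1` F).
Proof.
have inter_nonempty x (F : set T) : closed F ->
    (forall n, shrunk n x `&` F !=set0) -> exists2 a, F a & forall n, shrunk n x a.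
  move=> F_closed hitF.
  have [| | |a ha] := @nested_compact_nonempty T (fun n => shrunk n x `&` F) _ _ hitF.
  - exact: compact_closedI.
  - by move=> n; exact: closedI.
  - by move=> n a [/shrunk_decr na Fa].
  - by exists a => [|n]; [case: (ha 0%N)|case: (ha n)].
have /choice[sigma sigmaP] x : exists a, forall n, shrunk n x a.
  have [||a _ ?] := inter_nonempty x setT; [exact: closedT| |by exists a].
  by move=> n; rewrite setIT.
have sigma_unique x a : (forall n, shrunk n x a) -> a = sigma x.
  move=> ha; apply: contrapT => /C_separating[n [Ca Cs]].
  have [_ Cn] := sigmaP x n.+1.
  by apply/Cs/Cn; exists a; split; first exact: ha.
exists sigma; split=> [x|F F_closed]; first exact: (sigmaP x 0%N).
rewrite (_ : _ @^-1` F = \bigcap_n [set x | shrunk n x `&` F !=set0]).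
  by apply: bigcapT_measurable => n; exact: shrunk_hit.
apply/seteqP; split=> x /= => [Fs n _|hitF]; first by exists (sigma x).
have [a Fa ha] := inter_nonempty x F F_closed (fun n => hitF n I).
by rewrite -(sigma_unique x a).
Qed.

End measurable_selection.

(** * Measurable maximum theorem *)

Section continuous_reward.
Context {X T : topologicalType} {R : realType}.
Variables (Gamma : X -> set T) (r : X * T -> R).
Hypothesis r_continuous : {within graph Gamma, continuous r}.

(* Only the second factor needs a countable basis. *)
Lemma reward_gt_rectangles (B : nat -> set T) p : nat_basis B ->
  exists2 W : nat -> set X, (forall n, open (W n)) &
    forall x a, Gamma x a -> p < r (x, a) <-> exists n, W n x /\ B n a.
Proof.
move=> [_ B_nbhs].
pose W n := [set x | forall a, Gamma x a -> B n a -> p < r (x, a)]^°.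
exists W => [n|x a xa]; first exact: open_interior.
split=> [pr|[n [/interior_subset]]]; last exact.
have /(_ (x, a) xa) := (subspace_continuousP _ _).1 r_continuous.
move/cvgrPdist_lt => /(_ (r (x, a) - p)); rewrite subr_gt0 => /(_ pr).
move=> [[U V] /= [xU aV] UV].
have [n [Bna BV]] := B_nbhs _ _ aV.
exists n; split=> //; move: xU; apply: filterS => y Uy b yb /BV Vb.
have /(_ yb) := UV (y, b) (conj Uy Vb).
by move/(le_lt_trans (ler_norm _)); rewrite ltrD2l ltrN2.
Qed.

Lemma section_continuous x : {within Gamma x, continuous (fun a => r (x, a))}.
Proof.
apply/subspace_continuousP => a xa.
have /(_ (x, a) xa) r_xa := (subspace_continuousP _ _).1 r_continuous.
apply/cvgrPdist_lt => e e0.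
have [[U V] /= [xU aV] UV] := (cvgrPdist_lt _ _).1 r_xa e e0.
move: aV; apply: filterS => b Vb xb.
by apply: (UV (x, b)) => //; split=> //; exact: nbhs_singleton.
Qed.

End continuous_reward.

(** * Compactness and measurability of the set of maximizers *)

Section measurable_argmax.
Context d (X : measurableType d) {R : realType} {T : pseudoMetricType R}.
Variables (Gamma : X -> set T) (q : X -> T -> R).
Hypothesis Gamma_compact : forall x, compact (Gamma x).
Hypothesis Gamma_nonempty : forall x, Gamma x !=set0.
Hypothesis q_continuous : forall x, {within Gamma x, continuous (q x)}.
Hypothesis q_measurable : forall U c, open U ->
  measurable [set x | exists a, [/\ Gamma x a, U a & c < q x a]].

Definition argmax x := [set a | Gamma x a /\ forall b, Gamma x b -> q x b <= q x a].

Let cluster_ge x c (F : set_system T) p : Filter F -> Gamma x p -> cluster F p ->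
  F [set a | Gamma x a /\ c <= q x a] -> c <= q x p.
Proof.
move=> FF xp Fp Fc; rewrite leNgt; apply/negP => pc.
have /(_ p xp) := (subspace_continuousP _ _).1 (@q_continuous x).
move/cvgrPdist_lt => /(_ (c - q x p)); rewrite subr_gt0 => /(_ pc) near_p.
have [a [[xa ca] near_a]] := Fp _ _ Fc near_p.
move: (near_a xa); rewrite distrC => /(le_lt_trans (ler_norm _)).
by rewrite ltrD2r ltNge ca.
Qed.

Lemma argmax_compact x : compact (argmax x).
Proof.
move=> F FF Fmax.
have [|p [xp Fp]] := @Gamma_compact x F FF; first by apply: filterS Fmax => a [].
exists p; split=> //; split=> // b xb.
apply: (@cluster_ge x _ F p) => //.
by apply: filterS Fmax => a [xa maxa]; split=> //; exact: maxa.
Qed.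

(* Open neighbourhoods of F shrinking to F reduce the closed constraint to the
   open ones allowed in q_measurable. *)
Let near_set (F : set T) (n : nat) : set T :=
  \bigcup_(f in F) (ball f (n.+1%:R^-1 : R))^°.

Let near_set_open F n : open (near_set F n).
Proof. by apply: bigcup_open => f _; exact: open_interior. Qed.

(** For the converse, choose near-maximizers [u n] in shrinking neighbourhoods of [F]; a cluster
    point is a maximizer and lies in the closed set [F]. The levels are rational so that countably
    many conditions suffice, and [setT a] gives both sides the shape handled by [q_measurable]. *)
Let argmax_hitP F x : closed F -> argmax x `&` F !=set0 <->
  forall n (c : rat), (exists a, [/\ Gamma x a, setT a & ratr c < q x a]) ->
    exists a, [/\ Gamma x a, near_set F n a & ratr c < q x a].
Proof.
move=> F_closed; split=> [[p [[xp maxp] Fp]] n c [a [xa _ ca]]|hit].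
  exists p; split=> //; last exact: lt_le_trans ca (maxp _ xa).
  by exists p => //; apply: nbhsx_ballx; rewrite invr_gt0.
pose Q := q x @` Gamma x; pose m := sup Q.
have Q_nonempty : Q !=set0.
  by have [a xa] := Gamma_nonempty x; exists (q x a); exists a.
have Q_bounded : has_ubound Q.
  have /compact_bounded[M [_ QM]] : compact Q.
    by apply: continuous_compact; [exact: q_continuous|exact: Gamma_compact].
  exists (M + 1) => y Qy; apply: le_trans (ler_norm y) _.
  by apply: QM Qy; rewrite ltrDl.
have q_le_m a : Gamma x a -> q x a <= m.
  by move=> xa; apply: ub_le_sup => //; exists a.
have /choice[u uP] n : exists a,
    [/\ Gamma x a, near_set F n a & m - n.+1%:R^-1 < q x a].
  have mn : m - n.+1%:R^-1 < m by rewrite gtrBl invr_gt0.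
  (* A rational level just below the supremum [m] is exceeded on [Gamma x], hence near [F] as
     well. *)
  have [c /itvP c_itv] := rat_in_itvoo mn.
  have [_ [b xb <-] cb] : exists2 y, Q y & ratr c < y.
    by apply: sup_gt => //; rewrite c_itv.
  have [|a [xa Fa ca]] := hit n c; first by exists b.
  by exists a; split=> //; rewrite (lt_trans _ ca)// c_itv.
have u_near : \forall n \near \oo, Gamma x (u n).
  by exists 0%N => // n _; have [] := uP n.
have [p [xp up]] := @Gamma_compact x (u @ \oo) _ u_near.
exists p; split; [split=> // b xb|].
  apply/(le_trans (q_le_m _ xb))/ler_addgt0Pr => e e0; rewrite -lerBlDr.
  apply: (@cluster_ge x _ (u @ \oo)) => //.
  have := near_infty_natSinv_lt (PosNum e0); apply: filterS => n /= ne.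
  have [xu _ /ltW mu] := uP n; split=> //; apply: le_trans mu.
  by rewrite lerD2l lerN2 ltW.
apply: F_closed => V /nbhs_ballP[e /= e0 eV].
have e20 : 0 < e / 2 by rewrite divr_gt0.
have u_e : \forall n \near \oo, exists2 f, F f & ball f (e / 2) (u n).
  have := near_infty_natSinv_lt (PosNum e20); apply: filterS => n /= ne.
  have [_ [f Ff /interior_subset fu] _] := uP n; exists f => //.
  exact: le_ball (ltW ne) _ fu.
have [a [[f Ff fa] pa]] := up [set a | exists2 f, F f & ball f (e / 2) a]
  (ball p (e / 2)) u_e (nbhsx_ballx _ _ e20).
exists f; split=> //; apply: eV; rewrite /= [e]splitr.
exact: ball_triangle pa (ball_sym fa).
Qed.

(** The hitting criterion for [F = setT], where its condition holds trivially. *)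
Lemma argmax_nonempty x : argmax x !=set0.
Proof.
have [|p [xp _]] := (argmax_hitP x (@closedT T)).2; last by exists p.
move=> n c [a [xa _ ca]]; exists a; split=> //.
by exists a => //; apply: nbhsx_ballx; rewrite invr_gt0.
Qed.

Lemma argmax_hit_measurable : hit_measurable argmax.
Proof.
move=> F F_closed.
pose E U (c : rat) := [set x | exists a, [/\ Gamma x a, U a & ratr c < q x a]].
rewrite (_ : [set x | _] = ~` \bigcup_n \bigcup_c (E setT c `\` E (near_set F n) c)).
  apply: measurableC; apply: bigcupT_measurable => n.
  apply: bigcupT_measurable_rat => c.
  by apply: measurableD; apply: q_measurable => //; exact: openT.
apply/seteqP; split=> x /=.
  by move=> /(argmax_hitP _ F_closed) hit [n _ [c _ [/hit hn]]]; apply.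
move=> h; apply/(argmax_hitP _ F_closed) => n c hc; apply: contrapT => nhc.
by apply: h; exists n => //; exists c.
Qed.

End measurable_argmax.

Section measurable_maximum.
Context d (X : measurableType d) {R : realType} {T : ptopologicalType}.
Variables (B : nat -> set T) (Gamma : X -> set T) (r : X * T -> R).
Hypothesis B_basis : nat_basis B.
Hypothesis r_rectangles : forall p,
  exists2 W : nat -> set X, (forall n, measurable (W n)) &
    forall x a, Gamma x a -> p < r (x, a) <-> exists n, W n x /\ B n a.

(** Along a policy, the superlevel set of the reward is a countable union of traces of the
    rectangles. *)
Lemma measurable_reward (sigma : X -> T) :
  (forall U, open U -> measurable (sigma @^-1` U)) ->
  (forall x, Gamma x (sigma x)) ->
  measurable_fun setT (fun x => r (x, sigma x)).
Proof.
move=> sigma_measurable sigma_Gamma.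
apply: (measurability _ (RGenOInfty.measurableE R)) => _ [_ [p ->] <-].
have [W W_measurable WP] := r_rectangles p.
rewrite setTI (_ : _ @^-1` _ = \bigcup_n (W n `&` sigma @^-1` B n)).
  apply: bigcupT_measurable => n; apply: measurableI => //.
  by apply: sigma_measurable; apply: B_basis.1.
apply/seteqP; split=> x /=; rewrite in_itv /= andbT.
  by move/(WP _ _ (sigma_Gamma x)) => [n ?]; exists n.
by move=> [n _ ?]; apply/(WP _ _ (sigma_Gamma x)); exists n.
Qed.

Variable I : X -> T -> R.
Hypothesis Gamma_measurable : forall U, open U ->
  measurable [set x | Gamma x `&` U !=set0].
Hypothesis I_measurable : forall a, measurable_fun setT (I ^~ a).
Hypothesis I_continuous : forall x, continuous (I x).

(* Where r + I > c, a rational s can be inserted with I >= s near the maximizer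
   and r > c - s; continuity reduces I >= s on a basis element to countably many
   conditions. *)
Lemma measurable_exists_gt U c : open U ->
  measurable [set x | exists a, [/\ Gamma x a, U a & c < r (x, a) + I x a]].
Proof.
move=> U_open; have [B_open B_nbhs] := B_basis.
(* The points [e n] are dense. For an empty [B n] the point is arbitrary, which is harmless: [above]
   tests only points of the given basis element. *)
have /choice[e Be] n : exists e, B n !=set0 -> B n e.
  by have [[e ne]|] := pselect (B n !=set0); [exists e|exists point].
pose above n (s : rat) :=
  \bigcap_k [set x | B n (e k) -> ratr s <= I x (e k)].
have above_measurable n s : measurable (above n s).
  apply: bigcapT_measurable => k.
  have [Bk|Bk] := pselect (B n (e k)); last first.
    by rewrite (_ : [set x | _] = setT)//; apply/seteqP; split=> // x _ /Bk.
  rewrite (_ : [set x | _] = [set: X] `&` (I ^~ (e k)) @^-1` `[ratr s, +oo[).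
    by apply: I_measurable => //; exact: measurable_itv.
  rewrite setTI; apply/seteqP; split=> x /=; rewrite in_itv /= andbT; last by [].
  by apply.
have aboveP n s x : above n s x -> forall a, B n a -> ratr s <= I x a.
  move=> abv a na; rewrite leNgt; apply/negP => Ia.
  have [k [ka kV]] : exists k, B k a /\ B k `<=` [set b | I x b < ratr s] `&` B n.
    apply: B_nbhs; apply: filterI; last by apply: open_nbhs_nbhs; split.
    have /cvgrPdist_lt/(_ (ratr s - I x a)) := @I_continuous x a.
    rewrite subr_gt0 => /(_ Ia); apply: filterS => b; rewrite distrC.
    by move=> /(le_lt_trans (ler_norm _)); rewrite ltrD2r.
  have [/= Iek nek] : (I x (e k) < ratr s /\ B n (e k)).
    by apply: kV; apply: Be; exists a.
  by have := abv k Logic.I nek; rewrite /= leNgt Iek.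
have /choice[W WP] s : exists W : nat -> set X, (forall n, measurable (W n)) /\
    forall x a, Gamma x a -> c - ratr s < r (x, a) <-> exists n, W n x /\ B n a.
  by have [W ? ?] := r_rectangles (c - ratr s); exists W.
rewrite (_ : [set x | _] = \bigcup_(s : rat) \bigcup_n \bigcup_m
  (above n s `&` W s m `&` [set x | Gamma x `&` (U `&` B m `&` B n) !=set0])).
  apply: bigcupT_measurable_rat => s; apply: bigcupT_measurable => n.
  apply: bigcupT_measurable => m; apply: measurableI.
    by apply: measurableI => //; exact: (WP s).1.
  by apply: Gamma_measurable; do 2 apply: openI => //.
apply/seteqP; split=> x /=.
  move=> [a [xa Ua cr]].
  have /rat_in_itvoo[s /itvP s_itv] : c - r (x, a) < I x a by lra.
  have [n [na nV]] : exists n, B n a /\ B n `<=` [set b | ratr s < I x b].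
    apply: B_nbhs.
    have /cvgrPdist_lt/(_ (I x a - ratr s)) := @I_continuous x a.
    rewrite subr_gt0 s_itv => /(_ isT); apply: filterS => b.
    by move=> /(le_lt_trans (ler_norm _)); rewrite ltrD2l ltrN2.
  have [|m [Wm ma]] := ((WP s).2 x a xa).1.
    have : c - r (x, a) < ratr s by rewrite s_itv.
    lra.
  exists s => //; exists n => //; exists m => //; split; last by exists a.
  by split=> // k _ /= /nV /ltW.
move=> [s _ [n _ [m _ [[abv Wm] [a [xa [[Ua ma] na]]]]]]].
exists a; split=> //.
have Ia := aboveP _ _ _ abv _ na.
have : c - ratr s < r (x, a) by apply/((WP s).2 _ _ xa); exists m.
lra.
Qed.

End measurable_maximum.

(** * Nonlinear discounting *)

Section discounting_operator.
Context {Y : Type} {d} {Z : measurableType d} {R : realType}.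
Variables (P : R.-pker Z ~> Z) (delta : Z -> R).
Hypothesis delta_ge0 : forall z, 0 <= delta z.
Hypothesis delta_bm : bm delta.
Hypothesis discount_decreases : decreases_to setT
  (fun n => ereal_sup [set expected_discount P delta n.+1 z | z in [set: Z]]) 0%E.

Local Notation discounted := (discounted P delta).

Let discount n z := iter n discounted (cst 1) z.

Let cst1_nonneg : bm_nonneg (cst 1 : Z -> R).
Proof. by split=> [|?]; [exact: bm_cst|]. Qed.

Let discount_ge0 n z : 0 <= discount n z.
Proof.
by have [_ /(_ z)] := iter_discounted_nonneg P delta_ge0 delta_bm n cst1_nonneg.
Qed.

(** The sup norm of the [n]-fold discounted constant one, which serves as the Lipschitz constant of
    the [n]-th iterate. *)
Definition discount_bound n := sup (range (discount n)).

Lemma le_discount_bound n z : discount n z <= discount_bound n.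
Proof.
apply: ub_le_sup; last by exists z.
have [[_ /bounded_funE[M _ dM]] _] :=
  iter_discounted_nonneg P delta_ge0 delta_bm n cst1_nonneg.
by exists M => _ [z' _ <-]; apply: le_trans (ler_norm _) (dM z').
Qed.

Lemma discount_bound_ge0 n : 0 <= discount_bound n.
Proof. exact: le_trans (discount_ge0 n point) (le_discount_bound n point). Qed.

Lemma discount_bound_cvg0 : discount_bound @ \oo --> 0.
Proof.
apply/cvgrPdist_le => e e0.
have [decr [_ _ glb0]] := discount_decreases.
pose s n := ereal_sup [set expected_discount P delta n.+1 z | z in [set: Z]].
have [N sN] : exists N, (s N < e%:E)%E.
  apply: contrapT => /forallNP sN; suff : (e%:E <= 0)%E by rewrite lee_fin leNgt e0.
  by apply: glb0 => // _ [n _ <-]; rewrite leNgt; apply/negP; exact: sN.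
have s_decr n : (s (N + n)%N <= s N)%E.
  by elim: n => [|n IHn]; rewrite ?addn0// addnS (le_trans (decr _)).
exists N.+1 => // n /= Nn; rewrite sub0r normrN ger0_norm ?discount_bound_ge0//.
apply: ge_sup; first by exists (discount n point); exists point.
move=> _ [z _ <-]; rewrite -lee_fin -(expected_discountE P delta_ge0)//.
(* The term [s n] carries [n.+1] factors, hence the shift to [n.-1]. *)
apply: (@le_trans _ _ (s n.-1)).
  apply: ereal_sup_ubound; exists z => //.
  by rewrite prednK// (leq_ltn_trans _ Nn).
have /subnKC <- : (N <= n.-1)%N by rewrite -ltnS prednK// (leq_ltn_trans _ Nn).
exact: le_trans (s_decr _) (ltW sN).
Qed.

Variables (V : set (Y * Z -> R)) (F : (Y * Z -> R) -> Y * Z -> R).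

(** The weight [h] ignores the endogenous state, so the bound can be iterated whatever endogenous
    state is reached next. *)
Definition discounting := forall v w (h : Z -> R), V v -> V w -> bm_nonneg h ->
  (forall y z, `|v (y, z) - w (y, z)| <= h z) ->
  forall y z, `|F v (y, z) - F w (y, z)| <= discounted h z.

Hypothesis F_discounting : discounting.
Hypothesis F_V : forall v, V v -> V (F v).
Hypothesis V_within : forall v w, V v -> V w ->
  exists2 K, 0 <= K & uniformly_within K v w.

Let F_within n v w K : V v -> V w -> 0 <= K -> uniformly_within K v w ->
  uniformly_within (discount_bound n * K) (iter n F v) (iter n F w).
Proof.
move=> Vv Vw K0 vw.
have VF m u : V u -> V (iter m F u) by exact: iter_contraction_stable.
have K_nonneg : bm_nonneg (cst K : Z -> R) by split=> [|?]; [exact: bm_cst|].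
have step m y z :
    `|iter m F v (y, z) - iter m F w (y, z)| <= iter m discounted (cst K) z.
  elim: m y z => [y z|m IHm] /=; first exact: vw.
  by apply: F_discounting; [exact: VF|exact: VF|exact: iter_discounted_nonneg|].
move=> [y z]; apply: le_trans (step n y z) _; rewrite iter_discounted_cst// mulrC.
by rewrite ler_wpM2r// le_discount_bound.
Qed.

Lemma discounting_fixpoint_unique v w : V v -> F v = v -> V w -> F w = w -> v = w.
Proof.
exact: (contraction_fixpoint_unique discount_bound_cvg0 F_within V_within).
Qed.

Lemma discounting_fixpoint_ex : uniformly_closed V -> V !=set0 ->
  exists2 v, V v & F v = v.
Proof.
exact: (contraction_fixpoint_ex F_V discount_bound_ge0 discount_bound_cvg0
  F_within V_within).
Qed.

Lemma discounting_fixpoint_cvg v w x : V v -> F v = v -> V w ->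
  iter n F w x @[n --> \oo] --> v x.
Proof.
exact: (contraction_fixpoint_cvg discount_bound_cvg0 F_within V_within).
Qed.

End discounting_operator.

Section nonlinear_discounting.
Context (R : realType) (o : Order.disp_t) (dY dZ dA : measure_display)
  (Y : porderMeasurableTopologicalType o dY) (Z : measurableType dZ)
  (A : measurableType dA).
Variables (Gamma : Y * Z -> set A) (r : Y * Z * A -> R) (P : R.-pker Z ~> Z)
  (H : Y * A * Z -> Y) (beta : (Y * Z -> R) -> (Y * Z -> R))
  (Hbar : Y * Z -> Y) (delta : Z -> R).
Hypothesis Gamma_nonempty : forall x, Gamma x !=set0.
Hypothesis H_measurable : measurable_fun [set: Y * A * Z] H.
Hypothesis r_ge0 : forall xa, graph Gamma xa -> 0 <= r xa.
Hypothesis r_bounded : [bounded r xa | xa in graph Gamma].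
Hypothesis H_le_Hbar : forall y a z, (H (y, a, z) <= Hbar (y, z))%O.
Hypothesis Hbar_measurable : measurable_fun [set: Y * Z] Hbar.
Hypothesis Hbar_homo : forall z y1 y2, (y1 <= y2)%O ->
  (Hbar (y1, z) <= Hbar (y2, z))%O.
Hypothesis beta_bm : forall v, bm v -> bm (beta v).
Hypothesis beta_homo : forall v w, bm v -> bm w -> (v <= w)%O ->
  (beta v <= beta w)%O.
Hypothesis beta_subadditive : forall v w, bm v -> bm w ->
  (beta (v \+ w) <= beta v \+ beta w)%O.
Hypothesis delta_ge0 : forall z, 0 <= delta z.
Hypothesis delta_bm : bm delta.
Hypothesis beta_le : forall v, bm_nonneg v -> forall y z,
  beta v (y, z) <= delta z * v (y, z).
Hypothesis discount_decreases : decreases_to setT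
  (fun n => ereal_sup [set expected_discount P delta n.+1 z | z in [set: Z]]) 0%E.

Let bm0 : bm (cst 0 : Y * Z -> R). Proof. exact: bm_cst. Qed.

Let r_le_sup xa : graph Gamma xa -> r xa <= sup [set r xa | xa in graph Gamma].
Proof.
have [M [_ rM]] := r_bounded.
move=> Gxa; apply: ub_le_sup; last by exists xa.
exists (M + 1) => _ [xa' Gxa' <-]; apply: le_trans (ler_norm _) _.
by apply: rM => //; rewrite ltrDl.
Qed.

(** Subadditivity at zero reads [beta 0 <= beta 0 + beta 0], so [beta 0] is nonnegative;
    monotonicity does the rest. *)
Lemma beta_ge0 v : bm_nonneg v -> forall x, 0 <= beta v x.
Proof.
move=> [bv v0] x; apply: (@le_trans _ _ (beta (cst 0) x)); last first.
  have /lefP/(_ x) // : (beta (cst 0) <= beta v)%O.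
  by apply: beta_homo => //; apply/lefP => ?; exact: v0.
have /lefP/(_ x) := beta_subadditive bm0 bm0.
rewrite (_ : cst 0 \+ cst 0 = cst 0 :> (Y * Z -> R)) /=.
  by rewrite lerDl.
by apply/funext => ? /=; rewrite addr0.
Qed.

(** From [v <= w + |v - w|], monotonicity, subadditivity and the bound by [delta] give one
    inequality; exchanging [v] and [w] gives the other. *)
Lemma beta_lipschitz v w y z : bm v -> bm w ->
  `|beta v (y, z) - beta w (y, z)| <= delta z * `|v (y, z) - w (y, z)|.
Proof.
move=> bv bw.
have half v' w' : bm v' -> bm w' ->
    beta v' (y, z) - beta w' (y, z) <= delta z * `|v' (y, z) - w' (y, z)|.
  move=> bv' bw'; pose u x := `|v' x - w' x|.
  have bu : bm u by apply: bm_norm; exact: bmB.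
  have u_nonneg : bm_nonneg u by split=> // x; exact: normr_ge0.
  rewrite lerBlDl; apply: le_trans (lerD (lexx _) (beta_le u_nonneg y z)).
  apply: (@le_trans _ _ (beta (w' \+ u) (y, z))).
    have /lefP/(_ (y, z)) // : (beta v' <= beta (w' \+ u))%O.
    apply: beta_homo => //; first exact: bmD.
    by apply/lefP => x /=; rewrite -lerBlDl ler_norm.
  by have /lefP/(_ (y, z)) := beta_subadditive bw' bu.
rewrite ler_norml lerNl opprB half// andbT distrC.
exact: half.
Qed.

Lemma next_bm (w : Y * Z -> R) (s : Y * Z -> A) : bm_nonneg w ->
  measurable_fun setT s ->
  bm (fun x : Y * Z => \int[P x.2]_z' w (H (x.1, s x, z'), z')).
Proof.
move=> [bw w0] ms.
apply: (@kernel_integral_bm _ _ _ _ _ P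
  (fun xz => w (H (xz.1.1, s xz.1, xz.2), xz.2)) snd).
  split=> [|xz]; last exact: w0.
  apply: (@bm_comp _ _ _ _ _ (fun xz => (H (xz.1.1, s xz.1, xz.2), xz.2)) w) => //.
  apply: measurable_fun_pair; last exact: measurable_snd.
  apply: (@measurableT_comp _ _ _ _ _ _ H) => //.
  apply: measurable_fun_pair; last exact: measurable_snd.
  apply: measurable_fun_pair; first exact: measurableT_comp.
  exact: measurableT_comp.
exact: measurable_snd.
Qed.

Lemma bm_section (w : Y * Z -> R) (g : Z -> Y) : bm w -> measurable_fun setT g ->
  bm (fun z' => w (g z', z')).
Proof.
move=> bw mg; apply: (@bm_comp _ _ _ _ _ (fun z' => (g z', z')) w) => //.
exact: measurable_fun_pair.
Qed.

Let H_section_measurable y a : measurable_fun setT (fun z' => H (y, a, z')).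
Proof. exact: (@measurableT_comp _ _ _ _ _ _ H). Qed.

Let Hbar_section_measurable y : measurable_fun setT (fun z' => Hbar (y, z')).
Proof. exact: (@measurableT_comp _ _ _ _ _ _ Hbar). Qed.

Local Notation S := (dominating_operator Gamma r P delta Hbar).
Local Notation rsup := (sup [set r xa | xa in graph Gamma]).

Let rsup_ge0 : 0 <= rsup.
Proof.
have [a xa] := Gamma_nonempty point.
by apply: le_trans (r_le_sup (_ : graph Gamma (point, a))) => //; exact: r_ge0.
Qed.

Let delta_section_bm (v : Y * Z -> R) (g : Z -> Y) : bm v ->
  measurable_fun setT g -> bm (fun z' => delta z' * v (g z', z')).
Proof. by move=> bv mg; apply: bmM => //; exact: bm_section. Qed.

Lemma dominating_nonneg v : bm_nonneg v -> bm_nonneg (S v).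
Proof.
move=> [bv v0]; split; last first.
  by move=> x; rewrite addr_ge0// Rintegral_ge0// => z _; rewrite mulr_ge0.
apply: bmD; first exact: bm_cst.
apply: (@kernel_integral_bm _ _ _ _ _ P
  (fun xz : Y * Z * Z => delta xz.2 * v (Hbar (xz.1.1, xz.2), xz.2)) snd).
  split=> [|xz]; last by rewrite mulr_ge0.
  apply: bmM; first by apply: (bm_comp (g := snd)).
  apply: (@bm_comp _ _ _ _ _
    (fun xz : Y * Z * Z => (Hbar (xz.1.1, xz.2), xz.2)) v) => //.
  apply: measurable_fun_pair; last exact: measurable_snd.
  apply: (@measurableT_comp _ _ _ _ _ _ Hbar) => //.
  apply: measurable_fun_pair; last exact: measurable_snd.
  exact: measurableT_comp.
exact: measurable_snd.
Qed.

Lemma dominating_discounting : discounting P delta (@bm_nonneg _ _ R) S.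
Proof.
move=> v w h [bv v0] [bw w0] [bh h0] vw y z.
rewrite /dominating_operator opprD addrACA subrr add0r.
rewrite -kernel_integralB; [|exact: delta_section_bm..].
apply: normr_kernel_integral.
- by apply: bmB; exact: delta_section_bm.
- exact: bmM.
- by move=> z'; rewrite -mulrBr normrM ger0_norm// ler_wpM2l.
Qed.

Lemma bm_nonneg_uniformly_closed : uniformly_closed (@bm_nonneg _ (Y * Z)%type R).
Proof.
move=> g u v g0 u_nonneg uv; split.
  by apply: bm_uniformly_closed g0 _ uv => n; case: (u_nonneg n).
move=> x; apply: (cvgr_to_ge (uniformly_within_cvg (x := x) g0 uv)).
by near=> n; case: (u_nonneg n).
Unshelve. all: by end_near. Qed.

Lemma bm_nonneg_within (v w : Y * Z -> R) : bm_nonneg v -> bm_nonneg w ->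
  exists2 K, 0 <= K & uniformly_within K v w.
Proof. by move=> [bv _] [bw _]; exact: bm_within. Qed.

Let monotone_nonneg : set (Y * Z -> R) := [set v | bm_nonneg v /\
  forall z y1 y2, (y1 <= y2)%O -> v (y1, z) <= v (y2, z)].

(* The fixed point is found among functions increasing in the endogenous state,
   which is what lets it absorb the bound H <= Hbar. *)
Lemma dominating_fixpoint : exists b,
  [/\ bm_nonneg b, S b = b,
      forall z y1 y2, (y1 <= y2)%O -> b (y1, z) <= b (y2, z)
    & forall b', bm_nonneg b' -> S b' = b' -> b = b'].
Proof.
have S_monotone v : monotone_nonneg v -> monotone_nonneg (S v).
  move=> [v_nonneg v_homo]; split=> [|z y1 y2 y12]; first exact: dominating_nonneg.
  rewrite lerD2l; apply: le_kernel_integral => [||z'].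
  - by apply: delta_section_bm; first exact: v_nonneg.1.
  - by apply: delta_section_bm; first exact: v_nonneg.1.
  - by rewrite ler_wpM2l// v_homo// Hbar_homo.
have [| | | |b [b_nonneg b_homo] fix_b] := @discounting_fixpoint_ex Y _ Z R P delta
    delta_ge0 delta_bm discount_decreases monotone_nonneg S _ S_monotone.
- by move=> v w h [v_nonneg _] [w_nonneg _]; exact: dominating_discounting.
- by move=> v w [v_nonneg _] [w_nonneg _]; exact: bm_nonneg_within.
- move=> g u v g0 Vu uv; split.
    by apply: bm_nonneg_uniformly_closed g0 _ uv => n; case: (Vu n).
  move=> z y1 y2 y12.
  apply: (ler_cvg_to (uniformly_within_cvg (x := (y1, z)) g0 uv)
    (uniformly_within_cvg (x := (y2, z)) g0 uv)).
  by near=> n; have [_] := Vu n; apply.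
- by exists (cst 0); split=> //; split.
exists b; split=> // b' b'_nonneg fix_b'.
exact: (discounting_fixpoint_unique delta_ge0 delta_bm discount_decreases
  dominating_discounting dominating_nonneg bm_nonneg_within
  b_nonneg fix_b b'_nonneg fix_b').
Unshelve. all: by end_near. Qed.

(** * Policy and Bellman operators on the order interval [[0, b]] *)

Variable b : Y * Z -> R.
Hypothesis b_nonneg : bm_nonneg b.
Hypothesis fix_b : S b = b.
Hypothesis b_homo : forall z y1 y2, (y1 <= y2)%O -> b (y1, z) <= b (y2, z).
Hypothesis r_policy_measurable : forall sigma, policies Gamma sigma ->
  measurable_fun setT (fun x => r (x, sigma x)).
Hypothesis greedy_selection : forall w, bm_nonneg w -> exists sigma,
  policies Gamma sigma /\ forall x a, Gamma x a ->
    r (x, a) + \int[P x.2]_z' w (H (x.1, a, z'), z') <=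
    r (x, sigma x) + \int[P x.2]_z' w (H (x.1, sigma x, z'), z').

Local Notation V := (bm_below b).
Local Notation Sigma := (policies Gamma).
Local Notation T := (policy_operator r P beta H).

Let V_nonneg v : V v -> bm_nonneg v.
Proof. by move=> [bv vb]; split=> // x; case/andP: (vb x). Qed.

Let beta_nonneg v : bm_nonneg v -> bm_nonneg (beta v).
Proof. by move=> v_nonneg; split; [exact: beta_bm v_nonneg.1|exact: beta_ge0]. Qed.

(** The upper bound is the chain [beta v <= delta * v <= delta * b] at [H], then [b] at [H] below
    [b] at [Hbar]; with the reward below its supremum this yields [S b = b]. *)
Lemma policy_operator_stable sigma v : Sigma sigma -> V v -> V (T sigma v).
Proof.
move=> [msigma Gsigma] Vv; have v_nonneg := V_nonneg Vv; split.
  apply: bmD; last by apply: next_bm => //; exact: beta_nonneg.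
  split; first exact: r_policy_measurable.
  apply/bounded_funE; exists rsup => // x.
  by rewrite ger0_norm ?r_ge0// r_le_sup.
move=> [y z]; apply/andP; split.
  by rewrite addr_ge0 ?r_ge0// Rintegral_ge0// => z' _; exact: beta_ge0.
rewrite -fix_b lerD//; first exact: r_le_sup.
apply: le_kernel_integral => [||z'].
- by apply: bm_section => //; exact: beta_bm v_nonneg.1.
- exact: delta_section_bm b_nonneg.1 _.
- apply: le_trans (beta_le v_nonneg _ _) _; rewrite ler_wpM2l//.
  apply: (@le_trans _ _ (b (H (y, sigma (y, z), z'), z'))).
    by have [_ /(_ (H (y, sigma (y, z), z'), z'))/andP[]] := Vv.
  exact: b_homo.
Qed.

Lemma policy_operator_homo sigma v w : Sigma sigma -> V v -> V w ->
  (v <= w)%O -> (T sigma v <= T sigma w)%O.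
Proof.
move=> Ssigma /V_nonneg[bv _] /V_nonneg[bw _] vw; apply/lefP => -[y z].
rewrite lerD2l; apply: le_kernel_integral => [||z'].
- by apply: bm_section => //; exact: beta_bm.
- by apply: bm_section => //; exact: beta_bm.
- by have /lefP/(_ (H (y, sigma (y, z), z'), z')) := beta_homo bv bw vw.
Qed.

Lemma policy_operator_discounting sigma : discounting P delta V (T sigma).
Proof.
move=> v w h /V_nonneg[bv _] /V_nonneg[bw _] [bh h0] vw y z.
rewrite /policy_operator opprD addrACA subrr add0r.
rewrite -kernel_integralB; [|by apply: bm_section => //; exact: beta_bm..].
apply: normr_kernel_integral.
- by apply: bmB; (apply: bm_section => //; exact: beta_bm).
- exact: bmM.
- by move=> z'; rewrite (le_trans (beta_lipschitz _ _ bv bw))// ler_wpM2l.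
Qed.

Let T_adp : is_adp V Sigma T.
Proof.
split; [|exact: policy_operator_stable|exact: policy_operator_homo].
have [sigma [Ssigma _]] := greedy_selection b_nonneg.
by exists sigma.
Qed.

Let T_regular : regular V Sigma T.
Proof.
move=> v Vv.
have [sigma [Ssigma sigma_max]] := greedy_selection (beta_nonneg (V_nonneg Vv)).
exists sigma; split=> // tau [_ Gtau]; apply/lefP => x; exact: sigma_max.
Qed.

Let V_within v w : V v -> V w -> exists2 K, 0 <= K & uniformly_within K v w.
Proof. by move=> [bv _] [bw _]; exact: bm_within. Qed.

Let V_closed : uniformly_closed V.
Proof.
move=> g u v g0 Vu uv; split.
  by apply: bm_uniformly_closed g0 _ uv => n; case: (Vu n).
move=> x; apply/andP; split.
  apply: (cvgr_to_ge (uniformly_within_cvg (x := x) g0 uv)).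
  by near=> n; have [_ /(_ x)/andP[]] := Vu n.
apply: (cvgr_to_le (uniformly_within_cvg (x := x) g0 uv)).
by near=> n; have [_ /(_ x)/andP[]] := Vu n.
Unshelve. all: by end_near. Qed.

Let V_b : V b.
Proof.
by split=> [|x]; [exact: b_nonneg.1|rewrite lexx andbT; exact: b_nonneg.2].
Qed.

Let V_neq0 : V !=set0. Proof. by exists b. Qed.

Local Notation bellman := (bellman V Sigma T).

(** A policy greedy for [v'] is feasible at [w'], so the difference of Bellman values is at most the
    difference of that policy's values; the other sign is symmetric. *)
Lemma bellman_discounting : discounting P delta V bellman.
Proof.
move=> v w h Vv Vw h_nonneg vw y z.
have half v' w' : V v' -> V w' ->
    (forall y z, `|v' (y, z) - w' (y, z)| <= h z) ->
    bellman v' (y, z) - bellman w' (y, z) <= discounted P delta h z.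
  move=> Vv' Vw' vw'; have [sigma gsigma] := T_regular Vv'.
  rewrite (greedy_bellman T_adp Vv' gsigma).
  have /lefP/(_ (y, z)) Tw := bellman_ub T_adp T_regular Vw' gsigma.1.
  apply: (@le_trans _ _ (T sigma v' (y, z) - T sigma w' (y, z))).
    by rewrite lerD2l lerN2.
  apply: le_trans (ler_norm _) _.
  exact: policy_operator_discounting.
rewrite ler_norml lerNl opprB !half// => y' z'.
by rewrite distrC.
Qed.

(** If [T sigma v <= v], all iterates from [v] stay below [v], and so does their limit, the fixed
    point; dually for the other inequality. *)
Lemma policy_operator_order_stable sigma : Sigma sigma ->
  exists2 vsig, is_policy_value V T sigma vsig &
    forall v, V v -> ((T sigma v <= v)%O -> (vsig <= v)%O) /\
                     ((v <= T sigma v)%O -> (v <= vsig)%O).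
Proof.
move=> Ssigma; have Tdisc := @policy_operator_discounting sigma.
have T_V v : V v -> V (T sigma v) by exact: policy_operator_stable.
have [w Vw fix_w] := discounting_fixpoint_ex delta_ge0 delta_bm
  discount_decreases Tdisc T_V V_within V_closed V_neq0.
exists w => // v Vv.
have V_iter n : V (iter n (T sigma) v) by elim: n => //= n; exact: T_V.
have cvg_w x := discounting_fixpoint_cvg delta_ge0 delta_bm discount_decreases
  Tdisc T_V V_within (x := x) Vw fix_w Vv.
split=> Tv; apply/lefP => x.
  apply: (cvgr_to_le (cvg_w x)); near=> n.
  suff /lefP/(_ x) : (iter n (T sigma) v <= v)%O by [].
  elim: (n : nat) => //= m IHm; apply: le_trans Tv.
  exact: policy_operator_homo.
apply: (cvgr_to_ge (cvg_w x)); near=> n.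
suff /lefP/(_ x) : (v <= iter n (T sigma) v)%O by [].
elim: (n : nat) => //= m IHm; apply: le_trans Tv _.
exact: policy_operator_homo.
Unshelve. all: by end_near. Qed.

Lemma nonlinear_discounting_optimality :
  [/\ fundamental_optimality V Sigma T, vfi_converges V Sigma T,
      opi_converges V Sigma T & hpi_converges V Sigma T].
Proof.
have B_V v : V v -> V (bellman v) by exact: V_bellman.
have [vs V_vs fix_vs] := discounting_fixpoint_ex delta_ge0 delta_bm
  discount_decreases bellman_discounting B_V V_within V_closed V_neq0.
have B_cvg v : V v -> (v <= bellman v)%O ->
    increases_to V (fun n => iter n bellman v) vs.
  move=> Vv vB.
  have V_iter n : V (iter n bellman v) by elim: n => //= n; exact: B_V.
  have cvg_vs x := discounting_fixpoint_cvg delta_ge0 delta_bm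
    discount_decreases bellman_discounting B_V V_within (x := x) V_vs fix_vs Vv.
  have incr n : (iter n bellman v <= iter n.+1 bellman v)%O.
    elim: n => //= n; apply: bellman_homo => //; exact: (V_iter n.+1).
  (* An increasing sequence that converges pointwise to an element of [V] has it as supremum in
     [V]. *)
  split=> //; split=> // [_ [n _ <-]|w Vw ub_w]; apply/lefP => x.
    apply: (cvgr_to_ge (cvg_vs x)); exists n => // m /= nm.
    suff /lefP/(_ x) : (iter n bellman v <= iter m bellman v)%O by [].
    rewrite -(subnKC nm); elim: (m - n)%N => [|k IHk]; first by rewrite addn0.
    by rewrite addnS; exact: le_trans IHk (incr _).
  apply: (cvgr_to_le (cvg_vs x)); near=> n.
  by have /lefP/(_ x) := ub_w _ (ex_intro2 _ _ n I erefl).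
have stable := policy_operator_order_stable.
split.
- exact: fundamental_optimality_of_stable fix_vs B_cvg stable.
- exact: vfi_of_stable fix_vs B_cvg stable.
- exact: opi_of_stable fix_vs B_cvg stable.
- exact: hpi_of_stable fix_vs B_cvg stable.
Unshelve. all: by end_near. Qed.

End nonlinear_discounting.

Theorem proposition6p11 (R : realType) (o : Order.disp_t)
    (dY dZ dA : measure_display)
    (Y : porderMeasurableTopologicalType o dY)
    (Z : measurableTopologicalType dZ)
    (A : measurableMetricType R dA)
    (Y_borel : @measurable dY Y = <<s @open Y >>)
    (Z_borel : @measurable dZ Z = <<s @open Z >>)
    (A_borel : @measurable dA A = <<s @open A >>)
    (X_borel : @measurable _ (Y * Z)%type = <<s @open (Y * Z)%type >>)
    (A_separable : separable A)
    (Gamma : Y * Z -> set A) (r : Y * Z * A -> R) (P : R.-pker Z ~> Z)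
    (H : Y * A * Z -> Y) (beta : (Y * Z -> R) -> (Y * Z -> R))
    (Hbar : Y * Z -> Y) (delta : Z -> R)
    (Gamma_nonempty : forall x, Gamma x !=set0)
    (H_measurable : measurable_fun [set: Y * A * Z] H)
    (A1_compact : forall x, compact (Gamma x))
    (A1_continuous : continuous_correspondence Gamma)
    (A2_nonneg : forall xa, graph Gamma xa -> 0 <= r xa)
    (A2_bounded : [bounded r xa | xa in graph Gamma])
    (A2_continuous : {within graph Gamma, continuous r})
    (A3 : forall (v : Y * Z -> R) y z, bm v ->
      continuous (fun a : A => \int[P z]_z' v (H (y, a, z'), z')))
    (N1_sup : forall y z',
      isLub [set H (y, a, z') | a in [set: A]] (Hbar (y, z')))
    (N1_measurable : measurable_fun [set: Y * Z] Hbar)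
    (N1_monotone : forall z' y1 y2, (y1 <= y2)%O ->
      (Hbar (y1, z') <= Hbar (y2, z'))%O)
    (N2_self : forall v, bm v -> bm (beta v))
    (N2_monotone : forall v w, bm v -> bm w -> (v <= w)%O ->
      (beta v <= beta w)%O)
    (N3 : forall v w, bm v -> bm w ->
      (beta (v \+ w) <= beta v \+ beta w)%O)
    (N4_nonneg : forall z, 0 <= delta z)
    (N4_bounded : bounded_fun delta)
    (N4_measurable : measurable_fun [set: Z] delta)
    (N4 : forall v, bm_nonneg v -> forall y z,
      beta v (y, z) <= delta z * v (y, z))
    (N5 : decreases_to setT
      (fun n => ereal_sup [set expected_discount P delta n.+1 z | z in [set: Z]])
      0%E) :
  exists b : Y * Z -> R,
    let V := bm_below b in
    let Sigma := policies Gamma in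
    let T := policy_operator r P beta H in
    [/\ unique (fun b' => bm_nonneg b' /\
          dominating_operator Gamma r P delta Hbar b' = b') b,
        fundamental_optimality V Sigma T,
        vfi_converges V Sigma T,
        opi_converges V Sigma T
      & hpi_converges V Sigma T].
Proof.
have open_measurable_X (U : set (Y * Z)) : open U -> measurable U.
  by move=> U_open; rewrite X_borel; exact: sub_sigma_algebra.
have open_measurable_A (U : set A) : open U -> measurable U.
  by move=> U_open; rewrite A_borel; exact: sub_sigma_algebra.
have [B B_basis] := separable_nat_basis A_separable.
have r_rectangles p : exists2 W : nat -> set (Y * Z), (forall n, measurable (W n)) &
    forall x a, Gamma x a -> p < r (x, a) <-> exists n, W n x /\ B n a.
  have [W W_open WP] := reward_gt_rectangles A2_continuous p B_basis.
  by exists W => // n; exact: open_measurable_X.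
(* By lower hemicontinuity this set is open. *)
have Gamma_measurable (U : set A) : open U ->
    measurable [set x | Gamma x `&` U !=set0].
  move=> U_open; apply: open_measurable_X; rewrite openE => x xU.
  exact: A1_continuous.2.
have r_policy_measurable sigma : policies Gamma sigma ->
    measurable_fun setT (fun x => r (x, sigma x)).
  move=> [sigma_measurable sigma_Gamma].
  apply: (measurable_reward B_basis r_rectangles _ sigma_Gamma) => U U_open.
  rewrite -[_ @^-1` _]setTI; apply: sigma_measurable => //.
  exact: open_measurable_A.
have delta_bm : bm delta by split.
have H_le_Hbar y a z : (H (y, a, z) <= Hbar (y, z))%O.
  by have [+ _] := N1_sup y z; apply; exists a.
have greedy_selection w : bm_nonneg w -> exists sigma,
    policies Gamma sigma /\ forall x a, Gamma x a ->
    r (x, a) + \int[P x.2]_z' w (H (x.1, a, z'), z') <=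
    r (x, sigma x) + \int[P x.2]_z' w (H (x.1, sigma x, z'), z').
  move=> w_nonneg.
  pose I x a := \int[P x.2]_z' w (H (x.1, a, z'), z').
  pose q x a := r (x, a) + I x a.
  (* A fixed action is regarded as a constant policy. *)
  have I_measurable a : measurable_fun setT (I ^~ a).
    by have [] := next_bm P H_measurable w_nonneg (measurable_cst a).
  have I_continuous x : continuous (I x) by apply: A3; exact: w_nonneg.1.
  have q_continuous x : {within Gamma x, continuous (q x)}.
    move=> a; apply: cvgD; first exact: section_continuous.
    exact: continuous_subspaceT.
  have q_measurable (U : set A) c : open U ->
      measurable [set x | exists a, [/\ Gamma x a, U a & c < q x a]].
    exact: measurable_exists_gt B_basis r_rectangles _ Gamma_measurable
      I_measurable I_continuous _ _.
  have [sigma [sigma_max sigma_measurable]] := compact_measurable_selection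
    (@metric_hausdorff R A) (fun n => @closed_closure _ (B n))
    (nat_basis_separating B_basis)
    (argmax_compact A1_compact q_continuous)
    (argmax_nonempty A1_compact Gamma_nonempty q_continuous)
    (argmax_hit_measurable A1_compact Gamma_nonempty q_continuous q_measurable).
  exists sigma; split; last by move=> x a; exact: (sigma_max x).2.
  split=> [|x]; last exact: (sigma_max x).1.
  (* Open sets generate the sigma-algebra of [A], and the selection is known to pull closed sets
     back to measurable ones. *)
  apply: (measurability _ A_borel) => _ [U U_open <-].
  rewrite setTI -[U]setCK preimage_setC; apply: measurableC.
  exact: sigma_measurable (open_closedC U_open).
have [b [b_nonneg fix_b b_homo b_unique]] := dominating_fixpoint Gamma_nonempty
  A2_nonneg A2_bounded N1_measurable N1_monotone N4_nonneg delta_bm N5.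
exists b => V Sigma T.
have [? ? ? ?] := nonlinear_discounting_optimality Gamma_nonempty H_measurable
  A2_nonneg A2_bounded H_le_Hbar N1_measurable N2_self N2_monotone N3 N4_nonneg
  delta_bm N4 N5 b_nonneg fix_b b_homo r_policy_measurable greedy_selection.
split=> //; split=> // b' [b'_nonneg fix_b']; exact: b_unique.
Qed.
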